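(* Assume (A1), (A2) and (A3). Then for every bounded measurable $f:\mathsf X\to\mathbb R$, $$\lim_{n\to\infty}d\,\mathbb E\Big[\sum_{i=1}^d\theta_n(i)f(X_n)\mathbf 1_{\mathsf X_i}(X_n)\Big]=\int_{\mathsf X}f(x)\pi(x)\lambda(dx),$$ and $\mathcal I_n(f)\to\int_{\mathsf X}f(x)\pi(x)\lambda(dx)$ almost surely, where $$\mathcal I_n(f)=d\sum_{i=1}^d\theta_n(i)\Big(\frac1n\sum_{k=1}^nf(X_k)\mathbf 1_{\mathsf X_i}(X_k)\Big).$$
   Context: Setting: $(\mathsf X,\mathcal X)$ Polish space with Borel $\sigma$-algebra and $\sigma$-finite reference measure $\lambda$; $\pi$ a probability density w.r.t. $\lambda$; $d\ge2$; $\mathsf X_1,\dots,\mathsf X_d$ a measurable partition of $\mathsf X$; $I(x)=i$ iff $x\in\mathsf X_i$; $\theta_\star(i)=\int_{\mathsf X_i}\pi\,d\lambda$; $\Theta=\{\theta\in(0,1)^d:\sum_i\theta(i)=1\}$; $\pi_\theta(x)=\big(\sum_{i}\theta_\star(i)/\theta(i)\big)^{-1}\sum_{i}\frac{\pi(x)}{\theta(i)}\mathbf 1_{\mathsf X_i}(x)$. (A1): $0<\inf\pi\le\sup\pi<\infty$ and $\min_i\theta_\star(i)>0$. (A2): $P_\theta$ is the Metropolis–Hastings kernel with target $\pi_\theta\,d\lambda$ and symmetric proposal density $q$ w.r.t. $\lambda$ with $\inf_{\mathsf X^2}q>0$. (A3): $\{\gamma_n\}_{n\ge1}$ deterministic,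 $[0,1)$-valued, non-increasing, $\gamma_n\to0$, $\sum\gamma_n=\infty$, $\sum\gamma_n^2<\infty$. Linearized Wang–Landau algorithm: $X_0\in\mathsf X$, $\theta_0\in\Theta$; $X_{n+1}\sim P_{\theta_n}(X_n,\cdot)$ conditionally on $\mathcal F_n=\sigma(\theta_0,X_0,\dots,X_n)$; $\theta_{n+1}=\theta_n+\gamma_{n+1}H(X_{n+1},\theta_n)$ with $H_i(x,\theta)=\theta(i)(\mathbf 1_{\mathsf X_i}(x)-\theta(I(x)))$. *)

(* Defs.v *)
From HB Require Import structures.
From mathcomp Require Import all_boot all_order all_algebra.
From mathcomp Require Import all_classical all_reals all_analysis.
Set Implicit Arguments. Unset Strict Implicit. Unset Printing Implicit Defensive.
Import Order.TTheory GRing.Theory Num.Theory numFieldNormedType.Exports.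
Local Open Scope classical_set_scope.
Local Open Scope ring_scope.

Section PolishDefs.
Variables (R : realType) (X : Type) (dist : X -> X -> R).

Definition is_metric :=
  [/\ (forall x y, 0 <= dist x y), (forall x y, dist x y = 0 <-> x = y),
      (forall x y, dist x y = dist y x) &
      (forall x y z, dist x z <= dist x y + dist y z)].

Definition metric_open (U : set X) :=
  forall x, U x -> exists2 r : R, 0 < r & forall y, dist x y < r -> U y.

Definition metric_complete :=
  forall u : nat -> X,
    (forall e : R, 0 < e -> exists N, forall m n, (N <= m)%N -> (N <= n)%N ->
        dist (u m) (u n) < e) ->
    exists l, forall e : R, 0 < e -> exists N, forall n, (N <= n)%N -> dist (u n) l < e.

Definition metric_separable :=
  exists D : set X, countable D /\
    forall x (e : R), 0 < e -> exists2 y, D y & dist x y < e.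
End PolishDefs.

Definition polish_borel (R : realType) (d : measure_display) (X : measurableType d) :=
  exists dist : X -> X -> R,
    [/\ is_metric dist, metric_complete dist, metric_separable dist &
        (@measurable d X) = <<s metric_open dist >>].

Section WLDefs.
Variables (R : realType) (d : measure_display) (X : measurableType d).
Variables (lambda : {measure set X -> \bar R}) (pi : X -> R).
Variables (nd : nat) (Xs : 'I_nd -> set X).

Definition measurable_partition :=
  [/\ (forall i, measurable (Xs i)),
      (forall i j, i != j -> Xs i `&` Xs j = set0) &
      (forall x, exists i, Xs i x)].

(** I(x) = i iff x \in X_i  (None only if x lies in no X_i, impossible for a partition) *)
Definition Iof (x : X) : option 'I_nd := [pick i | `[< Xs i x >] ].

Definition thetaI (theta : 'I_nd -> R) (x : X) : R :=
  if Iof x is Some i then theta i else 0.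

Definition theta_star (i : 'I_nd) : R := fine (\int[lambda]_(x in Xs i) (pi x)%:E).

Definition in_Theta (theta : 'I_nd -> R) :=
  (forall i, 0 < theta i < 1) /\ \sum_(i < nd) theta i = 1.

Definition pi_theta (theta : 'I_nd -> R) (x : X) : R :=
  (\sum_(i < nd) theta_star i / theta i)^-1 *
  \sum_(i < nd) (pi x / theta i) * \1_(Xs i) x.

Variable q : X -> X -> R.

(** Metropolis-Hastings acceptance probability with target pi_theta and
    symmetric proposal q *)
Definition mh_accept (theta : 'I_nd -> R) (x y : X) : R :=
  Num.min 1 (pi_theta theta y / pi_theta theta x).

Definition mh_kernel (theta : 'I_nd -> R) (x : X) (A : set X) : R :=
  fine (\int[lambda]_(y in A) (q x y * mh_accept theta x y)%:E)
  + \1_A x * (1 - fine (\int[lambda]_y (q x y * mh_accept theta x y)%:E)).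

Definition Hwl (x : X) (theta : 'I_nd -> R) (i : 'I_nd) : R :=
  theta i * (\1_(Xs i) x - thetaI theta x).

Definition In_f (f : X -> R) (theta_n : 'I_nd -> R) (Xk : nat -> X) (n : nat) : R :=
  nd%:R * \sum_(i < nd) theta_n i *
    (n%:R^-1 * \sum_(1 <= k < n.+1) f (Xk k) * \1_(Xs i) (Xk k)).
End WLDefs.

Definition WL_filtration (R : realType) (dO : measure_display) (Omega : measurableType dO)
  (d : measure_display) (X : measurableType d) (nd : nat)
  (theta0 : Omega -> 'I_nd -> R) (Xn : nat -> Omega -> X) (n : nat) : set (set Omega) :=
  <<s [set B | (exists i (C : set R), measurable C /\ B = (fun w => theta0 w i) @^-1` C)
            \/ (exists k (A : set X), [/\ (k <= n)%N, measurable A & B = Xn k @^-1` A])] >>.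

(* Main.v *)
Require Import Defs.
From HB Require Import structures.
From mathcomp Require Import all_boot all_order all_algebra.
From mathcomp Require Import all_classical all_reals all_analysis.
From mathcomp Require Import measurable_realfun ring lra.
Set Implicit Arguments. Unset Strict Implicit. Unset Printing Implicit Defensive.
Import Order.TTheory GRing.Theory Num.Theory numFieldNormedType.Exports.
Local Open Scope classical_set_scope.
Local Open Scope ring_scope.

(* The proof rests on estimates that are uniform over the whole simplex Theta, so
   that no recurrence of theta_n to a compact subset is needed.  Since
   pi_theta <= sup pi / min theta_star, the kernel P_theta is minorized by
   rho * pi_theta with rho independent of theta, whence
   |P_theta^K g - pi_theta(g)| <= 2 (1 - rho)^K |g|.  The acceptance ratio only
   involves the quotients theta(i)/theta(j), and |theta_{n+1}(i) - theta_n(i)| <=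
   gamma_{n+1} theta_n(i), so P_{theta_{n+1}} - P_{theta_n} = O(gamma_{n+1}).
   Hence the sum of a_n (g - P_{theta_n} g)(X_{n+1}) is a convergent martingale
   plus a telescoping and an absolutely convergent part, for a_n = gamma_{n+1} and
   for a_n = 1/(n+1); summing over g, P g, ..., P^{K-1} g gives the same for
   g - P^K g, and a finite K is enough.

   With the weights gamma, the relative entropy L(theta) of theta_star with respect
   to theta satisfies L_{n+1} <= L_n - gamma_{n+1} (D(theta_n) - eps_K) + r_n, where
   the r_n have a convergent sum and D is the chi-square divergence divided by
   sum_i theta_star(i)/theta(i).  As D small forces L small, L_n -> 0, that is
   theta_n -> theta_star almost surely.  With the weights 1/n, Kronecker's lemma
   yields the law of large numbers.  For the expectations, E g(X_{n+1}) -
   E (P_{theta_star} g)(X_n) -> 0, which is iterated K times. *)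

(** * Relative entropy and chi-square divergence on the simplex *)

Section KullbackLeibler.
Context (R : realType) (d : nat).
Implicit Types (p t u : 'I_d -> R).

(** The drift D arises as follows: to first order an update lowers L by gamma_{n+1} times
    theta_star(I(X_{n+1})) - theta_n(I(X_{n+1})), and the pi_theta-mean of theta_star(I) - theta(I)
    is exactly D(theta). Lack of compactness is harmless for this L. With m > 0 a lower bound of
    theta_star and Z = sum_i theta_star(i)/theta(i), one has sum_i theta_star(i)^2/theta(i) >= m Z,
    so D >= m - 1/Z: near the boundary of the simplex, where L and Z blow up, D cannot be small. A
    solution of the Poisson equation would be an infinite series of iterates of P_theta, whose
    variation in theta would have to be summed. Truncation at K keeps the Lipschitz constants
    explicit at the price of the bias eps_K = 2 (1 - rho)^K; K is fixed by the target precision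
    before n tends to infinity. The transition law is given on events only. Conditional expectations
    are therefore replaced by integrals against bounded F_n-measurable test functions, and (A1)
    makes lambda finite, so that bounded measurable functions are integrable under lambda as well as
    under P. *)

Definition kl p t : R := \sum_(i < d) p i * ln (p i / t i).

(** Applying [ln y <= y - 1] to [y = (1 + x)^-1] gives [ln (1 + x) >= x / (1 + x)]; what remains is
    [x ^+ 2 * (1 + 2 * x) / (1 + x) >= 0], whence the threshold [- 2^-1]. *)
Lemma ln1D_ge (x : R) : - 2^-1 <= x -> x - 2 * x ^+ 2 <= ln (1 + x).
Proof.
move=> hx; have x1 : 0 < 1 + x by lra.
have : ln (1 + ((1 + x)^-1 - 1)) <= (1 + x)^-1 - 1.
  by apply: le_ln1Dx; have := invr_gt0 (1 + x); rewrite x1; lra.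
rewrite addrCA subrr addr0 lnV ?posrE// => h.
apply: (@le_trans _ _ (1 - (1 + x)^-1)); last lra.
rewrite -subr_ge0.
have -> : 1 - (1 + x)^-1 - (x - 2 * x ^+ 2) = x ^+ 2 * (1 + 2 * x) / (1 + x).
  by field; rewrite gt_eqF.
by apply: divr_ge0; [apply: mulr_ge0; [exact: sqr_ge0|lra]|exact: ltW].
Qed.

Lemma ln_le_sub1 (x : R) : 0 < x -> ln x <= x - 1.
Proof.
by move=> x0; rewrite -{1}(subrK 1 x) addrC; apply: le_ln1Dx; lra.
Qed.

(** A Hellinger bound: adding the terms [t j - p j], of total sum 0, makes each summand at least the
    squared difference of the square roots, and [t i - p i] is that difference times a sum of roots
    that is at most 2. *)
Lemma kl_ge_sqr p t i : (forall j, 0 < p j <= 1) -> (forall j, 0 < t j <= 1) ->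
  \sum_(j < d) p j = 1 -> \sum_(j < d) t j = 1 ->
  (t i - p i) ^+ 2 <= 4 * kl p t.
Proof.
move=> hp ht sp st.
have p0 j : 0 < p j by case/andP: (hp j).
have t0 j : 0 < t j by case/andP: (ht j).
have -> : kl p t = \sum_(j < d) (p j * ln (p j / t j) + (t j - p j)).
  by rewrite big_split /= big_split /= sumrN sp st subrr addr0.
have key j : (Num.sqrt (t j) - Num.sqrt (p j)) ^+ 2 <=
    p j * ln (p j / t j) + (t j - p j).
  have [sp0 st0] : 0 < Num.sqrt (p j) /\ 0 < Num.sqrt (t j).
    by rewrite !sqrtr_gt0.
  have Ep : p j = Num.sqrt (p j) ^+ 2 by rewrite sqr_sqrtr// ltW.
  have Et : t j = Num.sqrt (t j) ^+ 2 by rewrite sqr_sqrtr// ltW.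
  move: sp0 st0 Ep Et; set a := Num.sqrt (p j); set b := Num.sqrt (t j).
  move=> a0 b0 -> ->.
  (* The logarithm becomes [- 2 * ln (b / a)], and [ln x <= x - 1] at [b / a] leaves exactly
     [(b - a) ^+ 2]. *)
  have -> : a ^+ 2 / b ^+ 2 = (b / a)^-1 * (b / a)^-1.
    by field; rewrite !gt_eqF.
  have ba : 0 < b / a by apply: divr_gt0.
  rewrite lnM ?posrE ?invr_gt0// lnV ?posrE//.
  have := ln_le_sub1 ba => h.
  have : a ^+ 2 * ln (b / a) <= a ^+ 2 * (b / a - 1).
    by rewrite ler_wpM2l// sqr_ge0.
  have -> : a ^+ 2 * (b / a - 1) = a * b - a ^+ 2 by field; rewrite gt_eqF.
  nra.
apply: (@le_trans _ _ (4 * (Num.sqrt (t i) - Num.sqrt (p i)) ^+ 2)).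
  have Ep : p i = Num.sqrt (p i) ^+ 2 by rewrite sqr_sqrtr// ltW.
  have Et : t i = Num.sqrt (t i) ^+ 2 by rewrite sqr_sqrtr// ltW.
  have p1 : Num.sqrt (p i) <= 1.
    by rewrite -[leRHS]sqrtr1 ler_sqrt//; case/andP: (hp i).
  have t1 : Num.sqrt (t i) <= 1.
    by rewrite -[leRHS]sqrtr1 ler_sqrt//; case/andP: (ht i).
  rewrite {1}Ep {1}Et subr_sqr exprMn mulrC ler_wpM2r ?sqr_ge0//.
  have -> : 4 = 2 ^+ 2 :> R by ring.
  rewrite ler_sqr ?nnegrE; have := sqrtr_ge0 (p i); have := sqrtr_ge0 (t i); lra.
rewrite ler_wpM2l// (bigD1 i)//= -[leLHS]addr0 lerD//.
by apply: sumr_ge0 => j _; apply: le_trans (key j); exact: sqr_ge0.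
Qed.

Definition chi2 p t : R := \sum_(i < d) p i ^+ 2 / t i - 1.

Lemma chi2_ge0 p t : (forall j, 0 < t j) ->
  \sum_(j < d) p j = 1 -> \sum_(j < d) t j = 1 -> 0 <= chi2 p t.
Proof.
move=> t0 sp st.
have -> : chi2 p t = \sum_(i < d) (p i - t i) ^+ 2 / t i.
  transitivity (\sum_(i < d) (p i ^+ 2 / t i - p i *+ 2 + t i)); last first.
    by apply: eq_bigr => i _; field; rewrite gt_eqF.
  by rewrite !big_split /= sumrN sumrMnl sp st /chi2; ring.
by apply: sumr_ge0 => i _; rewrite divr_ge0 ?sqr_ge0// ltW.
Qed.

(** Since [m * Z <= chi2 p t + 1], the bounds [chi2 p t <= e * Z] and [2 * e <= m] force
    [Z <= 2 / m]; then [kl <= chi2 <= e * Z], the first inequality by [ln x <= x - 1]. *)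
Lemma kl_le_drift p t (m e : R) : 0 < m -> (forall j, m <= p j) ->
  (forall j, 0 < t j) -> \sum_(j < d) p j = 1 -> \sum_(j < d) t j = 1 ->
  0 <= e -> 2 * e <= m -> chi2 p t / (\sum_(i < d) p i / t i) <= e ->
  kl p t <= 2 / m * e.
Proof.
move=> m0 mp t0 sp st e0 em.
set Z := \sum_(i < d) p i / t i => DZ.
have p0 j : 0 < p j by apply: lt_le_trans (mp j).
have mZ : m * Z <= chi2 p t + 1.
  rewrite /chi2 subrK mulr_sumr; apply: ler_sum => i _.
  by rewrite mulrA ler_wpM2r ?invr_ge0 ?(ltW (t0 i))// expr2 ler_wpM2r// ltW.
have Z0 : 0 < Z.
  have : 0 <= Z by apply: sumr_ge0 => i _; rewrite divr_ge0// ltW.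
  rewrite le_eqVlt => /predU1P[Z0|//].
  have : \sum_(i < d) p i / t i = 0 by rewrite -[LHS]/Z -Z0.
  move/eqP; rewrite psumr_eq0; last by move=> i _; rewrite divr_ge0// ltW.
  move=> /allP h.
  have : \sum_(j < d) p j = 0.
    apply: big1 => j _; have := h j (mem_index_enum j).
    by rewrite /= mulf_eq0 invr_eq0 !gt_eqF.
  by rewrite sp => /eqP; rewrite oner_eq0.
move: DZ; rewrite ler_pdivrMr// => DZ.
have Zm : Z <= 2 / m.
  rewrite ler_pdivlMr//; nra.
apply: (@le_trans _ _ (chi2 p t)); last first.
  by apply: le_trans DZ _; rewrite mulrC ler_wpM2r.
have -> : chi2 p t = \sum_(i < d) p i * (p i / t i - 1).
  transitivity (\sum_(i < d) (p i ^+ 2 / t i - p i)).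
    by rewrite big_split/= sumrN sp.
  by apply: eq_bigr => i _; field; rewrite gt_eqF.
apply: ler_sum => i _; rewrite ler_wpM2l ?(ltW (p0 i))//.
by apply: ln_le_sub1; rewrite divr_gt0.
Qed.

(** Each coordinate changes by [- p j * ln (1 + g * u j)]; [g <= 2^-1] keeps [g * u j] in the range
    of [ln1D_ge], which leaves the second-order error. *)
Lemma kl_step p t t' u (g : R) : (forall j, 0 < p j) -> (forall j, 0 < t j) ->
  \sum_(j < d) p j = 1 -> 0 <= g <= 2^-1 -> (forall j, `|u j| <= 1) ->
  (forall j, t' j = t j * (1 + g * u j)) ->
  kl p t' <= kl p t - g * \sum_(j < d) p j * u j + 2 * g ^+ 2.
Proof.
move=> p0 t0 sp /andP[g0 g2] u1 tE.
rewrite -[X in _ + X]mulr1 -sp !mulr_sumr -sumrB -big_split /=.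
apply: ler_sum => j _.
have gu : `|g * u j| <= g by rewrite normrM ger0_norm// ler_piMr.
have gu2 : (g * u j) ^+ 2 <= g ^+ 2.
  by rewrite -(real_normK (num_real (g * u j))) lerXn2r ?nnegrE.
move: gu; rewrite ler_norml => /andP[gu _].
have l0 : 0 < 1 + g * u j by lra.
have -> : p j / t' j = (p j / t j) / (1 + g * u j).
  by rewrite tE; field; rewrite !gt_eqF.
rewrite [ln (_ / (1 + _))]ln_div ?posrE ?divr_gt0//.
have h : g * u j - 2 * (g * u j) ^+ 2 <= ln (1 + g * u j) by apply: ln1D_ge; lra.
have : p j * (g * u j - 2 * (g * u j) ^+ 2) <= p j * ln (1 + g * u j).
  by rewrite ler_wpM2l// ltW.
have : p j * (g * u j) ^+ 2 <= p j * g ^+ 2 by rewrite ler_wpM2l// ltW.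
nra.
Qed.
End KullbackLeibler.

(** * Series, averages and a descent argument for real sequences *)

Section RealSequences.
Context (R : realType).
Implicit Types (u v x a g e : R ^nat).

(** Abel summation: apart from the telescoping part of [a n * v n], which tends to 0, there remains
    [(a n.+1 - a n) * v n.+1], dominated by the telescoping series of [M * (a n - a n.+1)]. *)
Lemma is_cvg_series_telescope (a v : R ^nat) (M : R) :
  (forall n, 0 <= a n) -> (forall n, a n.+1 <= a n) -> a @ \oo --> 0 ->
  (forall n, `|v n| <= M) ->
  cvgn (series (fun n => a n * (v n - v n.+1))).
Proof.
move=> a0 adec acvg vM.
have -> : (fun n => a n * (v n - v n.+1)) =
    - telescope (fun n => a n * v n) + (fun n => (a n.+1 - a n) * v n.+1).
  by apply/funext => n; rewrite /telescope /= !fctE; ring.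
apply: is_cvg_seriesD.
  rewrite is_cvg_seriesN telescopeK.
  apply: is_cvgB; last exact: is_cvg_cst.
  apply/cvg_ex; exists 0; apply/cvgr0Pnorm_lt => eps eps0.
  have M0 : 0 <= M by apply: le_trans (vM 0%N).
  have /cvgr0Pnorm_lt : a @ \oo --> 0 by [].
  have eM : 0 < eps / (M + 1) by rewrite divr_gt0// ltr_wpDl.
  move=> /(_ _ eM); apply: filterS => n an; rewrite normrM.
  move: an; rewrite ltr_pdivlMr; last by rewrite ltr_wpDl.
  apply: le_lt_trans; rewrite ler_wpM2l//.
  by apply: le_trans (vM n) _; rewrite lerDl.
suff : cvgn [normed series (fun n => (a n.+1 - a n) * v n.+1)].
  by move/normed_cvg.
have av : cvgn (series (fun n => M * (a n - a n.+1))).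
  have -> : (fun n => M * (a n - a n.+1)) = (- M) *: telescope a.
    by apply/funext => n; rewrite /telescope /= !fctE /GRing.scale /=; ring.
  apply: is_cvg_seriesZ; rewrite telescopeK.
  apply: is_cvgB; last exact: is_cvg_cst.
  by apply/cvg_ex; exists 0.
have M0 : 0 <= M by apply: le_trans (vM 0%N).
apply: (series_le_cvg _ _ _ av) => n.
- exact: normr_ge0.
- by apply: mulr_ge0; rewrite ?subr_ge0.
have dn : `|a n.+1 - a n| = a n - a n.+1 by rewrite distrC ger0_norm// subr_ge0.
by rewrite /= normrM dn mulrC ler_wpM2r// subr_ge0.
Qed.

Lemma sum_cvg (I : Type) (s : seq I) (f : I -> R ^nat) (l : I -> R) :
  (forall i, f i @ \oo --> l i) ->
  (fun n => \sum_(i <- s) f i n) @ \oo --> \sum_(i <- s) l i.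
Proof.
move=> fl; elim: s => [|i s IH].
  by under eq_fun do rewrite big_nil; rewrite big_nil; exact: cvg_cst.
by under eq_fun do rewrite big_cons; rewrite big_cons; exact: cvgD.
Qed.

(** Summation by parts turns the mean into a partial sum minus a Cesaro mean of partial sums, and
    both have the same limit. *)
Lemma kronecker x : cvgn (series (fun k => k.+1%:R^-1 * x k)) ->
  (fun n => n%:R^-1 * \sum_(0 <= k < n) x k) @ \oo --> 0.
Proof.
set s := series _ => /cvg_ex[l sl].
have E n : \sum_(0 <= k < n) x k = n%:R * s n - \sum_(0 <= k < n) s k.
  elim: n => [|n IH]; first by rewrite !big_geq// mul0r subrr.
  rewrite !big_nat_recr//= IH /s !seriesEnat/= big_nat_recr//=.
  have n0 : (n.+1%:R : R) != 0 by rewrite pnatr_eq0.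
  set S := \sum_(0 <= k < n) _; set T := \sum_(0 <= i < n) _.
  by rewrite -natr1; field; rewrite natr1.
suff : (fun n => n.+1%:R^-1 * \sum_(0 <= k < n.+1) x k) @ \oo --> 0.
  by move=> h; rewrite -cvg_shiftS.
have -> : (fun n => n.+1%:R^-1 * \sum_(0 <= k < n.+1) x k) =
    (fun n => s n.+1) - arithmetic_mean s.
  by apply/funext => n; rewrite !fctE /= E mulrBr mulKf ?pnatr_eq0.
have -> : 0 = l - l by rewrite subrr.
apply: cvgB; last exact: cesaro.
by have := sl; rewrite -cvg_shiftS.
Qed.

Lemma cesaro_mean u (l : R) : u @ \oo --> l ->
  (fun n => n%:R^-1 * \sum_(0 <= k < n) u k) @ \oo --> l.
Proof.
by move=> /cesaro ul; rewrite -cvg_shiftS; move: ul; rewrite /arithmetic_mean seriesEnat.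
Qed.

(** Divergence of the steps [g] forces [D] below [2 * eps] at some late time, where [L <= del].
    Afterwards, up to the errors [e], [L] can rise only while [D <= 2 * eps], that is from a value
    at most [del], and by at most [g * eps]. *)
Lemma descent (L D g e : R ^nat) (eps del eta : R) :
  0 < eps -> 0 < eta -> (forall n, 0 <= L n) -> (forall n, 0 <= D n) ->
  (forall n, 0 <= g n) -> g @ \oo --> 0 -> series g @ \oo --> +oo ->
  cvgn (series e) ->
  (\forall n \near \oo, L n.+1 <= L n - g n * (D n - eps) + e n) ->
  (forall n, D n <= 2 * eps -> L n <= del) ->
  \forall n \near \oo, L n <= del + eta.
Proof.
move=> eps0 eta0 L0 D0 g0 gcvg gdvg /cvg_ex[l el] [N0 _ LN] LD.
have et4 : 0 < eta / 4 by rewrite divr_gt0.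
have /cvgrPdist_lt/(_ _ et4)[N1 _ eN] := el.
have ee0 : 0 < eta / 4 / eps by rewrite divr_gt0.
have /cvgr0Pnorm_lt/(_ _ ee0)[N2 _ gN] := gcvg.
pose N := maxn N0 (maxn N1 N2).
have {}LN n : (N <= n)%N -> L n.+1 <= L n - g n * (D n - eps) + e n.
  by move=> h; apply: LN; apply: leq_trans h; rewrite leq_maxl.
have {}eN n : (N <= n)%N -> l - eta / 4 < series e n < l + eta / 4.
  move=> h; have Nn : (N1 <= n)%N by apply: leq_trans h; rewrite leq_max leq_maxl orbT.
  have := eN n Nn; rewrite /=.
  by rewrite ltr_norml => /andP[? ?]; lra.
have {}gN n : (N <= n)%N -> g n * eps < eta / 4.
  move=> h; have Nn : (N2 <= n)%N by apply: leq_trans h; rewrite leq_max leq_maxr orbT.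
  have := gN n Nn; rewrite /=.
  by rewrite ger0_norm// ltr_pdivlMr.
have eS n : series e n.+1 = series e n + e n.
  by rewrite !seriesEnat /= big_nat_recr.
have gS n : series g n.+1 = series g n + g n.
  by rewrite !seriesEnat /= big_nat_recr.
(* Otherwise [L - series e] would drop by at least [eps * g n] at every step after [N],
   contradicting [0 <= L]. *)
have [n0 Nn0 Dn0] : exists2 n0, (N <= n0)%N & D n0 <= 2 * eps.
  apply: contrapT => H.
  have HD n : (N <= n)%N -> 2 * eps < D n.
    by move=> Nn; rewrite ltNge; apply/negP => ?; apply: H; exists n.
  have key k : L (N + k)%N - series e (N + k)%N <=
      L N - series e N - eps * (series g (N + k)%N - series g N).
    elim: k => [|k IH]; first by rewrite addn0 subrr mulr0 subr0.
    rewrite addnS eS gS; have Nk : (N <= N + k)%N by rewrite leq_addr.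
    have := LN _ Nk; have := HD _ Nk; have := g0 (N + k)%N => gk Dk.
    have : 0 <= g (N + k)%N * (D (N + k)%N - 2 * eps).
      by rewrite mulr_ge0// subr_ge0 ltW.
    lra.
  have /cvgryPge/(_ (series g N + (L N + eta) / eps))[K _ gK] := gdvg.
  have := gK (N + K)%N; rewrite /= leq_addl => /(_ isT).
  rewrite -lerBrDl ler_pdivrMr// mulrC => h.
  have := key K; have := L0 (N + K)%N.
  have /andP[] := eN _ (leqnn N); have /andP[] := eN _ (leq_addr K N).
  lra.
(* The invariant bounds [L - series e] rather than [L], so that successive errors never accumulate;
   [eta / 2] absorbs one step [g * eps] and the oscillation of [series e]. *)
have inv k : L (n0 + k)%N - series e (n0 + k)%N <= del + eta / 2 - l.
  elim: k => [|k IH].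
    rewrite addn0; have := LD _ Dn0; have /andP[] := eN _ Nn0.
    lra.
  rewrite addnS eS; have Nk : (N <= n0 + k)%N.
    by apply: leq_trans Nn0 _; rewrite leq_addr.
  have := LN _ Nk; have := gN _ Nk; have /andP[] := eN _ Nk.
  have gk := g0 (n0 + k)%N; have Dk0 := D0 (n0 + k)%N.
  have gD : 0 <= g (n0 + k)%N * D (n0 + k)%N by rewrite mulr_ge0.
  have [Dk|Dk] := leP (D (n0 + k)%N) (2 * eps).
    have := LD _ Dk; lra.
  have : 0 <= g (n0 + k)%N * (D (n0 + k)%N - 2 * eps).
    by rewrite mulr_ge0// subr_ge0 ltW.
  have : 0 <= g (n0 + k)%N * eps by rewrite mulr_ge0// ltW.
  lra.
exists n0 => // n /= n0n; have := inv (n - n0)%N; rewrite subnKC//.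
have /andP[] := eN _ (leq_trans Nn0 n0n); lra.
Qed.
End RealSequences.

(** * Bounded measurable functions and their integrals *)

Section BoundedMeasurable.
Context (R : realType) (dT : measure_display) (T : measurableType dT).
Implicit Types (f g : T -> R).

(** The bound holds everywhere and refers to no measure, so the same predicate serves on the state
    space, on [Omega] and on products. *)
Definition bmeas f := measurable_fun setT f /\ exists M, forall x, `|f x| <= M.

Lemma bmeas_cst (r : R) : bmeas (fun=> r).
Proof. by split; [exact: measurable_cst|exists `|r|]. Qed.

Lemma bmeasD f g : bmeas f -> bmeas g -> bmeas (fun x => f x + g x).
Proof.
move=> [mf [M fM]] [mg [N gN]]; split; first exact: measurable_funD.
by exists (M + N) => x; rewrite (le_trans (ler_normD _ _))// lerD.
Qed.

Lemma bmeasM f g : bmeas f -> bmeas g -> bmeas (fun x => f x * g x).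
Proof.
move=> [mf [M fM]] [mg [N gN]]; split; first exact: measurable_funM.
by exists (M * N) => x; rewrite normrM ler_pM.
Qed.

Lemma bmeasN f : bmeas f -> bmeas (fun x => - f x).
Proof.
move=> [mf [M fM]]; split; first exact: measurable_funN.
by exists M => x; rewrite normrN.
Qed.

Lemma bmeasB f g : bmeas f -> bmeas g -> bmeas (fun x => f x - g x).
Proof. by move=> bf bg; apply: bmeasD => //; exact: bmeasN. Qed.

Lemma bmeas_indic (A : set T) : measurable A -> bmeas (\1_A : T -> R).
Proof.
move=> mA; split; first exact: measurable_indic.
by exists 1 => x; rewrite indicE; case: (_ \in _); rewrite ?normr1 ?normr0.
Qed.

Lemma bmeas_sum (I : Type) (s : seq I) (f : I -> T -> R) :
  (forall i, bmeas (f i)) -> bmeas (fun x => \sum_(i <- s) f i x).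
Proof.
move=> bf; elim: s => [|i s IH].
  under eq_fun do rewrite big_nil; exact: bmeas_cst.
by under eq_fun do rewrite big_cons; exact: bmeasD.
Qed.

Context (mu : {finite_measure set T -> \bar R}).

Lemma bmeas_integrable f : bmeas f -> mu.-integrable setT (EFin \o f).
Proof.
move=> [mf [M fM]]; apply: measurable_bounded_integrable => //.
  by rewrite ltey_eq fin_num_measure.
exists M; split; first exact: num_real.
by move=> N MN x _; apply: le_trans (fM x) (ltW MN).
Qed.

Lemma bmeas_RintegralE f : bmeas f ->
  (\int[mu]_x (f x)%:E)%E = (\int[mu]_x f x)%:E.
Proof.
by move=> bf; rewrite fineK//; apply: integrable_fin_num => //;
  exact: bmeas_integrable.
Qed.

Lemma bmeas_RintegralD f g : bmeas f -> bmeas g ->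
  \int[mu]_x (f x + g x) = \int[mu]_x f x + \int[mu]_x g x.
Proof. by move=> *; rewrite RintegralD//; exact: bmeas_integrable. Qed.

Lemma bmeas_RintegralB f g : bmeas f -> bmeas g ->
  \int[mu]_x (f x - g x) = \int[mu]_x f x - \int[mu]_x g x.
Proof. by move=> *; rewrite RintegralB//; exact: bmeas_integrable. Qed.

Lemma bmeas_RintegralZl (r : R) f : bmeas f ->
  \int[mu]_x (r * f x) = r * \int[mu]_x f x.
Proof. by move=> *; rewrite RintegralZl//; exact: bmeas_integrable. Qed.

Lemma bmeas_Rintegral_sum (I : Type) (s : seq I) (f : I -> T -> R) :
  (forall i, bmeas (f i)) ->
  \int[mu]_x (\sum_(i <- s) f i x) = \sum_(i <- s) \int[mu]_x f i x.
Proof.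
move=> bf; elim: s => [|i s IH].
  rewrite big_nil; under eq_Rintegral do rewrite big_nil.
  by rewrite Rintegral_cst// mul0r.
rewrite big_cons -IH -bmeas_RintegralD//; last exact: bmeas_sum.
by under eq_Rintegral do rewrite big_cons.
Qed.

Lemma bmeas_le_Rintegral f g : bmeas f -> bmeas g ->
  (forall x, f x <= g x) -> \int[mu]_x f x <= \int[mu]_x g x.
Proof. by move=> *; apply: le_Rintegral => //; exact: bmeas_integrable. Qed.

Lemma bmeas_cvg_Rintegral (h : nat -> T -> R) f (M : R) :
  (forall n, measurable_fun setT (h n)) -> measurable_fun setT f ->
  (forall n x, `|h n x| <= M) ->
  {ae mu, forall x, h ^~ x @ \oo --> f x} ->
  (fun n => \int[mu]_x h n x) @ \oo --> \int[mu]_x f x.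
Proof.
move=> mh mf hM hf.
have := @dominated_convergence _ _ _ mu setT measurableT
  (fun n => EFin \o h n) (EFin \o f) (cst M%:E) _ _ _ _ _.
case.
- by move=> n; exact/measurable_EFinP.
- exact/measurable_EFinP.
- apply: filterS hf => x hx _; by apply: cvg_EFin; [exact: nearW|exact: hx].
- exact: finite_measure_integrable_cst.
- by apply: aeW => x n _; rewrite /= lee_fin.
move=> intf _ h2; apply: fine_cvg; rewrite /Rintegral fineK//.
exact: integrable_fin_num.
Qed.
End BoundedMeasurable.

Lemma prob_Rintegral_cst (R : realType) (dO : measure_display)
    (Omega : measurableType dO) (P : probability Omega R) (r : R) :
  \int[P]_w r = r.
Proof.
rewrite Rintegral_cst//.
by rewrite (congr1 (fun x => r * fine x) (probability_setT P : _ = 1%E)) mulr1.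
Qed.

(** * Almost sure convergence of martingale series *)

Section MartingaleSeries.
Context (R : realType) (dO : measure_display) (Omega : measurableType dO).
Context (P : probability Omega R) (Gen : nat -> set (set Omega)).
Hypothesis Gen_sub : forall n, Gen n `<=` measurable.
Hypothesis Gen_incr : forall n, Gen n `<=` Gen n.+1.

(** [g_sigma_algebraType (Gen n)] is [Omega] with the sigma-algebra generated by [Gen n]:
    adaptedness is plain measurability on that type and inherits its closure rules. *)
Definition adapted n dU (U : measurableType dU) (Y : Omega -> U) :=
  measurable_fun setT (Y : g_sigma_algebraType (Gen n) -> U).

Lemma adapted_measurable n dU (U : measurableType dU) (Y : Omega -> U) :
  adapted n Y -> measurable_fun setT Y.
Proof.
move=> aY _ B mB; have := aY measurableT B mB.
move: (_ `&` _); apply: smallest_sub => //.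
exact: sigma_algebra_measurable.
Qed.

Lemma adaptedW n m dU (U : measurableType dU) (Y : Omega -> U) :
  (n <= m)%N -> adapted n Y -> adapted m Y.
Proof.
move=> nm aY _ B mB; have := aY measurableT B mB.
have : Gen n `<=` Gen m.
  move: nm; elim: m => [|m IH]; first by rewrite leqn0 => /eqP->.
  rewrite leq_eqVlt => /predU1P[->//|]; rewrite ltnS => /IH h.
  exact: subset_trans (@Gen_incr m).
by move=> h; apply: sub_smallest2r => //; exact: smallest_sigma_algebra.
Qed.

(** A vanishing conditional expectation given the past, expressed through bounded adapted test
    functions. *)
Definition martingale_diff (xi : nat -> Omega -> R) :=
  forall n (Y : Omega -> R), adapted n Y -> (exists M, forall w, `|Y w| <= M) ->
    \int[P]_w (Y w * xi n w) = 0.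

Section Maximal.
Variables (xi : nat -> Omega -> R) (c : R ^nat) (eps : R).
Hypothesis xi_adapted : forall n, adapted n.+1 (xi n).
Hypothesis xi_le : forall n w, `|xi n w| <= c n.
Hypothesis xi_mdiff : martingale_diff xi.
Hypothesis eps0 : 0 < eps.

Let S n w := \sum_(0 <= k < n) xi k w.

(** Indicator that |S| has stayed below [eps] up to time n. It is adapted at time n, hence
    predictable as a factor of [xi n]; at time 0 it is 1 because [S 0] vanishes. *)
Fixpoint below n w : R :=
  if n is m.+1 then below m w * \1_[set v | `|S m.+1 v| < eps] w else 1.

(* The martingale stopped when |S| first reaches eps: it coincides with S before
   that time, and keeps a modulus >= eps from then on. *)
Let Tn n w := \sum_(0 <= k < n) below k w * xi k w.

Let SS n w : S n.+1 w = S n w + xi n w.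
Proof. by rewrite /S big_nat_recr. Qed.

Let TS n w : Tn n.+1 w = Tn n w + below n w * xi n w.
Proof. by rewrite /Tn big_nat_recr. Qed.

Let S_adapted n : adapted n (S n).
Proof.
elim: n => [|n IH].
  have -> : S 0%N = cst 0 by apply/funext => w; rewrite /S big_geq.
  exact: measurable_cst.
have -> : S n.+1 = (S n \+ xi n) by apply/funext => w; rewrite SS.
by apply: measurable_funD; [exact: adaptedW IH|exact: xi_adapted].
Qed.

Let below_adapted n : adapted n (below n).
Proof.
elim: n => [|n IH]; first exact: measurable_cst.
apply: measurable_funM; first exact: adaptedW IH.
apply: measurable_indic.
rewrite -[X in measurable X]setTI.
have : measurable_fun setT (fun w : g_sigma_algebraType (Gen n.+1) => `|S n.+1 w| < eps).
  apply: measurable_fun_ltr; last exact: measurable_cst.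
  by apply: measurableT_comp => //; exact: S_adapted.
move=> /(_ measurableT [set true])/(_ _); apply => //.
Qed.

Let T_adapted n : adapted n (Tn n).
Proof.
elim: n => [|n IH].
  have -> : Tn 0%N = cst 0 by apply/funext => w; rewrite /Tn big_geq.
  exact: measurable_cst.
have -> : Tn n.+1 = (Tn n \+ (below n \* xi n)) by apply/funext => w; rewrite TS.
apply: measurable_funD; first exact: adaptedW IH.
by apply: measurable_funM; [exact: (adaptedW (leqnSn n) (@below_adapted n))|exact: xi_adapted].
Qed.

Let below_norm n w : `|below n w| <= 1.
Proof.
elim: n => [|n IH]; first by rewrite normr1.
rewrite /= normrM -[leRHS]mulr1 ler_pM// indicE.
by case: (_ \in _); rewrite ?normr1 ?normr0.
Qed.

Let T_bound n : exists M, forall w, `|Tn n w| <= M.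
Proof.
elim: n => [|n [M hM]].
  by exists 0 => w; rewrite /Tn big_geq// normr0.
exists (M + 1 * c n) => w; rewrite TS (le_trans (ler_normD _ _))// lerD//.
by rewrite normrM ler_pM.
Qed.

Let below_alt n w :
  [/\ below n w = 1, Tn n w = S n w & forall k, (k <= n)%N -> `|S k w| < eps] \/
  below n w = 0 /\ eps <= `|Tn n w|.
Proof.
elim: n => [|n [[b1 TE Sk]|[b0 Te]]].
- left; split => //; first by rewrite /Tn /S !big_geq.
  by move=> k; rewrite leqn0 => /eqP ->; rewrite /S big_geq// normr0.
- have TE' : Tn n.+1 w = S n.+1 w by rewrite TS SS b1 mul1r TE.
  have [Slt|Sge] := ltP `|S n.+1 w| eps; [left|right].
    split => //; first by rewrite /= b1 mul1r indicE mem_set.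
    move=> k; rewrite leq_eqVlt => /predU1P[->//|]; rewrite ltnS; exact: Sk.
  split; last by rewrite TE'.
  by rewrite /= indicE memNset ?mulr0// => /=; rewrite ltNge Sge.
- by right; split; [rewrite /= b0 mul0r|rewrite TS b0 mul0r addr0].
Qed.

Let bmeas_T n : bmeas (Tn n).
Proof. by split; [exact: adapted_measurable (@T_adapted n)|exact: T_bound]. Qed.

Let bmeas_xi n : bmeas (xi n).
Proof.
split; first exact: adapted_measurable (@xi_adapted n).
by exists (c n).
Qed.

Let bmeas_below n : bmeas (below n).
Proof.
split; first exact: adapted_measurable (@below_adapted n).
by exists 1.
Qed.

(** Orthogonality of increments: [Tn n * below n] is bounded and adapted, so its cross term with
    [xi n] integrates to 0. *)
Let T_sqr n : \int[P]_w (Tn n w ^+ 2) <= \sum_(0 <= k < n) c k ^+ 2.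
Proof.
elim: n => [|n IH].
  rewrite big_geq// /Tn; under eq_Rintegral do rewrite big_geq// expr0n.
  by rewrite (prob_Rintegral_cst P).
rewrite big_nat_recr//=; apply: le_trans (lerD IH (lexx _)).
have E w : Tn n.+1 w ^+ 2 = Tn n w * Tn n w + 2 * (Tn n w * below n w * xi n w)
    + (below n w * xi n w) * (below n w * xi n w) by rewrite TS; ring.
under eq_Rintegral do rewrite E.
have b1 := bmeasM (bmeas_T n) (bmeas_T n).
have b2 := bmeasM (bmeasM (bmeas_T n) (bmeas_below n)) (bmeas_xi n).
have b2' := bmeasM (bmeas_cst _ 2) b2.
have b3 := bmeasM (bmeas_below n) (bmeas_xi n).
have b3' := bmeasM b3 b3.
rewrite bmeas_RintegralD//; last exact: bmeasD.
rewrite bmeas_RintegralD// bmeas_RintegralZl// xi_mdiff; last 2 first.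
- by apply: measurable_funM; [exact: T_adapted|exact: below_adapted].
- by have [] := bmeasM (bmeas_T n) (bmeas_below n).
rewrite mulr0 addr0; under eq_Rintegral do rewrite -expr2.
rewrite lerD2l; apply: (@le_trans _ _ (\int[P]_w (c n ^+ 2))).
  apply: bmeas_le_Rintegral => //; first exact: bmeas_cst.
  move=> w; rewrite -expr2 -[leLHS]real_normK ?num_real// lerXn2r ?nnegrE//.
    exact: le_trans (xi_le n w).
  by rewrite normrM -[leRHS]mul1r ler_pM.
by rewrite (prob_Rintegral_cst P).
Qed.

Lemma maximal_measurable : measurable [set w | exists k, eps <= `|S k w|].
Proof.
have -> : [set w | exists k, eps <= `|S k w|] =
    \bigcup_k ~` ([set: Omega] `&` [set w | `|S k w| < eps]).
  apply/seteqP; split => [w [k ek]|w [k _ /=]].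
    by exists k => //= -[_]; rewrite ltNge ek.
  by move=> h; exists k; rewrite leNgt; apply/negP => ?; apply: h.
apply: bigcup_measurable => k _; apply: measurableC.
have : measurable_fun setT (fun w => `|S k w| < eps).
  apply: measurable_fun_ltr; last exact: measurable_cst.
  by apply: measurableT_comp => //; exact: adapted_measurable (@S_adapted k).
by move=> /(_ measurableT [set true]); apply.
Qed.

(** Chebyshev for the stopped sum: where [below n] vanishes, [eps ^+ 2 <= Tn n ^+ 2]. These events
    increase to the one in the statement, and the bound does not depend on n. *)
Lemma maximal_inequality (C : R) :
  (forall n, \sum_(0 <= k < n) c k ^+ 2 <= C) ->
  (P [set w | exists k, (eps <= `|S k w|)%R] <= (C / eps ^+ 2)%:E)%E.
Proof.
move=> hC.
pose B n := below n @^-1` [set 0].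
have mB n : measurable (B n).
  rewrite -[B n]setTI; apply: (adapted_measurable (@below_adapted n)) => //.
have PB n : (P (B n) <= (C / eps ^+ 2)%:E)%E.
  have -> : P (B n) = (\int[P]_w \1_(B n) w)%:E.
    rewrite -(@bmeas_RintegralE _ _ _ P); last exact: bmeas_indic.
    by rewrite integral_indic// setIT.
  rewrite lee_fin ler_pdivlMr ?exprn_gt0// mulrC.
  apply: le_trans (hC n); apply: le_trans (T_sqr n).
  have bT2 : bmeas (fun w => Tn n w ^+ 2) by exact: (bmeasM (bmeas_T n) (bmeas_T n)).
  rewrite -bmeas_RintegralZl; last exact: bmeas_indic.
  apply: bmeas_le_Rintegral => //.
    by apply: bmeasM; [exact: bmeas_cst|exact: bmeas_indic].
  move=> w; rewrite indicE; have [|_] := boolP (w \in B n); last first.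
    by rewrite mulr0 sqr_ge0.
  rewrite inE /B /= => b0; rewrite mulr1.
  have [[b1 _ _]|[_ eT]] := below_alt n w.
    by have := b1; rewrite b0 => /eqP; rewrite eq_sym oner_eq0.
  rewrite -[leRHS]real_normK ?num_real// lerXn2r ?nnegrE//; exact: ltW.
have BE : [set w | exists k, eps <= `|S k w|] = \bigcup_n B n.
  apply/seteqP; split => [w [k ek]|w [n _ /= bn]].
    exists k => //; have [[_ _ h]|[]//] := below_alt k w.
    by have := h k (leqnn k); rewrite ltNge ek.
  apply: contrapT => H.
  suff : below n w = 1 by rewrite bn => /eqP; rewrite eq_sym oner_eq0.
  have Hk k : `|S k w| < eps.
    by rewrite ltNge; apply/negP => ?; apply: H; exists k.
  elim: (n) => [//|m IH]; by rewrite /= IH mul1r indicE mem_set//=; exact: Hk.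
have := @nondecreasing_cvg_mu _ _ _ P B mB (bigcup_measurable (fun k _ => mB k)).
rewrite BE => /(_ _)/cvg_lim <- //; last first.
  move=> n m nm; apply/subsetPset => w; rewrite /B /=.
  move: nm; elim: m => [|m IH]; first by rewrite leqn0 => /eqP->.
  rewrite leq_eqVlt => /predU1P[->//|]; rewrite ltnS => nm bn.
  by rewrite /= IH// mul0r.
apply: lime_le; last by apply: nearW => n /=; exact: PB.
apply/cvg_ex; eexists; apply: nondecreasing_cvg_mu => //.
  exact: bigcup_measurable.
move=> n m nm; apply/subsetPset => w; rewrite /B /=.
move: nm; elim: m => [|m IH]; first by rewrite leqn0 => /eqP->.
rewrite leq_eqVlt => /predU1P[->//|]; rewrite ltnS => nm bn.
by rewrite /= IH// mul0r.
Qed.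
End Maximal.

(** The maximal inequality applies to the series restarted at m: it ever reaches e with probability
    at most the tail of [c ^+ 2] from m, divided by [e ^+ 2]. Almost surely some restart therefore
    stays below e, and letting e run through the inverses of the positive integers gives the Cauchy
    criterion. *)
Lemma martingale_series_cvg (xi : nat -> Omega -> R) (c : R ^nat) :
  (forall n, adapted n.+1 (xi n)) -> (forall n w, `|xi n w| <= c n) ->
  martingale_diff xi -> cvgn (series (fun n => c n ^+ 2)) ->
  {ae P, forall w, cvgn (series (fun n => xi n w))}.
Proof.
move=> xia xic xim /cvg_ex[l sl].
pose xi' m n w := if (n < m)%N then 0 else xi n w.
pose c' m n := if (n < m)%N then 0 else c n.
pose S' m k w := \sum_(0 <= n < k) xi' m n w.
have c0 n : 0 <= c n by apply: le_trans (xic n point).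
have nds : {homo series (fun n => c n ^+ 2) : a b / (a <= b)%N >-> a <= b}.
  by apply: nondecreasing_series => n _ _; exact: sqr_ge0.
have sle n : series (fun n => c n ^+ 2) n <= l.
  by have := nondecreasing_cvgn_le nds (cvgP _ sl) n; rewrite (cvg_lim _ sl).
have c'le m n : \sum_(0 <= k < n) c' m k ^+ 2 <=
    l - series (fun n => c n ^+ 2) m.
  have [nm|/ltnW mn] := leqP n m.
    rewrite big_nat big1 ?subr_ge0// => k /andP[_ kn].
    by rewrite /c' (leq_trans kn nm) expr0n.
  rewrite lerBrDl; apply: le_trans (sle n).
  rewrite !seriesEnat /= (big_cat_nat (leq0n m) mn)//= [leRHS](big_cat_nat (leq0n m) mn)//=.
  rewrite lerD2l (_ : \sum_(0 <= i < m) _ = 0) ?add0r; last first.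
    rewrite big_nat big1// => k /andP[_ km].
    by rewrite /c' km expr0n.
  apply: ler_sum_nat => k /andP[mk _].
  by rewrite /c' ltnNge mk.
have key (e : R) : 0 < e -> {ae P, forall w, exists m, forall k, `|S' m k w| < e}.
  move=> e0; pose E m := [set w | exists k, e <= `|S' m k w|].
  have xia' m n : adapted n.+1 (xi' m n).
    rewrite /adapted /xi'; case: (n < m)%N; last exact: xia.
    exact: measurable_cst.
  have xic' m n w : `|xi' m n w| <= c' m n.
    by rewrite /xi' /c'; case: ifP; rewrite ?normr0.
  have xim' m : martingale_diff (xi' m).
    move=> n Y aY bY; rewrite /xi'; case: (n < m)%N; last exact: xim.
    by under eq_Rintegral do rewrite mulr0; exact: prob_Rintegral_cst.
  have mE m : measurable (E m) by exact: (@maximal_measurable (xi' m) e (xia' m)).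
  have PE m : (P (E m) <= ((l - series (fun n => c n ^+ 2) m) / e ^+ 2)%:E)%E.
    exact: (@maximal_inequality (xi' m) (c' m) e).
  (* The exceptional set lies in every [E m], so its measure is at most every tail bound, and these
     tend to 0. *)
  exists (\bigcap_m E m); split.
  - exact: bigcap_measurable.
  - apply/eqP; rewrite eq_le measure_ge0 andbT.
    pose r m := ((l - series (fun n => c n ^+ 2) m) / e ^+ 2)%:E.
    have h : r @ \oo --> 0%:E.
      apply: cvg_EFin; first exact: nearW.
      have -> : 0 = (l - l) / e ^+ 2 by rewrite subrr mul0r.
      by apply: cvgMl; apply: cvgB => //; exact: cvg_cst.
    apply: (@le_trans _ _ (limn r)); last by rewrite (cvg_lim _ h).
    apply: lime_ge; first by apply/cvg_ex; exists 0%:E.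
    apply: nearW => m; apply: le_trans (PE m).
    apply: le_measure; rewrite ?inE//; first exact: bigcap_measurable.
    exact: bigcap_inf.
  - move=> w /= H m _; apply: contrapT => h2; apply: H; exists m => k.
    by rewrite ltNge; apply/negP => ?; apply: h2; exists k.
have : {ae P, forall w, forall j, exists m, forall k, `|S' m k w| < j.+1%:R^-1}.
  by apply: ae_foralln => j; apply: key; rewrite invr_gt0.
apply: filterS => w hw; apply/cauchy_cvgP/cauchy_seriesP => e e0.
have [j je] : exists j, j.+1%:R^-1 < e / 2.
  have [j _ hj] := (near_infty_natSinv_lt (PosNum (divr_gt0 e0 (ltr0n R 2)))).
  by exists j; exact: (hj j (leqnn j)).
have [m hm] := hw j.
have SE k : (m <= k)%N -> S' m k w = \sum_(m <= n < k) xi n w.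
  move=> mk; rewrite /S' (big_cat_nat (leq0n m) mk)//= big_nat big1 ?add0r.
    by apply: eq_big_nat => i /andP[mi _]; rewrite /xi' ltnNge mi.
  by move=> i /andP[_ im]; rewrite /xi' im.
exists ([set n | (m <= n)%N], [set n | (m <= n)%N]); first by split; exists m.
move=> [a b] [/= ma mb].
have [ab|ba] := leqP a b; last by rewrite big_geq ?normr0// ltnW.
have -> : \sum_(a <= n < b) xi n w = S' m b w - S' m a w.
  by rewrite !SE// [in RHS](big_cat_nat ma ab)/= [X in X - _]addrC addrK.
rewrite (splitr e); apply: le_lt_trans (ler_normB _ _) _.
by apply: ltrD; apply: lt_trans je; exact: hm.
Qed.
End MartingaleSeries.

(** * Measurability of inverses and parameter integrals; a Lipschitz bound *)

Section MeasurabilityAux.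
(** The inverse is x times the real power -1 of [x ^+ 2], and [powR] is measurable; at 0 both sides
    are 0. *)
Lemma measurable_invr (R : realType) : measurable_fun setT (fun x : R => x^-1).
Proof.
have -> : (fun x : R => x^-1) = (fun x => x * (x ^+ 2) `^ (-1)).
  apply/funext => x; rewrite powR_inv1 ?sqr_ge0//.
  have [->|x0] := eqVneq x 0; first by rewrite invr0 mul0r.
  by field.
apply: measurable_funM => //.
by apply: (measurableT_comp (measurable_powR (-1))); exact: exprn_measurable.
Qed.

Lemma measurable_funV (R : realType) d (T : measurableType d) (f : T -> R) :
  measurable_fun setT f -> measurable_fun setT (fun x => (f x)^-1).
Proof. by move=> mf; exact: (measurableT_comp (@measurable_invr R)). Qed.

(** Tonelli gives measurability of partial integrals of nonnegative functions; splitting into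
    positive and negative parts extends it to [h] without joint integrability. *)
Lemma measurable_fun_Rintegral (R : realType) d1 d2 (Z : measurableType d1)
    (X : measurableType d2) (mu : {finite_measure set X -> \bar R}) (h : Z * X -> R) :
  measurable_fun setT h -> measurable_fun setT (fun z => \int[mu]_y h (z, y)).
Proof.
move=> mh; apply: (measurableT_comp (@fine_measurable R setT measurableT)).
have meh : measurable_fun setT (EFin \o h) by exact/measurable_EFinP.
have -> : (fun z => \int[mu]_y (h (z, y))%:E)%E =
    (fun z => \int[mu]_y (EFin \o h)^\+ (z, y) - \int[mu]_y (EFin \o h)^\- (z, y))%E.
  apply/funext => z; rewrite integralE.
  by congr (_ - _)%E; apply: eq_integral => y _; rewrite ?funeposE ?funenegE.
apply: emeasurable_funB.
- exact: (measurable_fun_fubini_tonelli_F (m2 := mu) (EFin \o h)^\+%E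
    (measurable_funepos meh) (fun _ => funepos_ge0 _ _)).
- exact: (measurable_fun_fubini_tonelli_F (m2 := mu) (EFin \o h)^\-%E
    (measurable_funeneg meh) (fun _ => funeneg_ge0 _ _)).
Qed.

(** [r] and [r'] stand for acceptance ratios before and after an update, [a] and [b] for the
    relative changes of the two coordinates of theta involved. If [4^-1 <= s] the bound is at least
    1, the length of [0, 1]; otherwise [b] is at least 3/4. *)
Lemma min1_lipschitz (R : realType) (r r' a b s : R) : 0 <= s -> 0 <= r -> 0 <= r' ->
  1 - s <= a <= 1 + s -> 1 - s <= b <= 1 + s -> r' * b = r * a ->
  `|Num.min 1 r' - Num.min 1 r| <= 4 * s.
Proof.
move=> s0 r0 r'0 /andP[a1 a2] /andP[b1 b2] e.
have [s4|s4] := lerP (4^-1) s.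
  by rewrite ler_norml; case: (leP 1 r); case: (leP 1 r'); lra.
rewrite ler_norml; case: (leP 1 r) => h; case: (leP 1 r') => h'; rewrite ?subrr; nra.
Qed.

End MeasurabilityAux.

(** * The Metropolis-Hastings kernel, uniformly in theta *)

Section MetropolisHastings.
Context (R : realType) (dX : measure_display) (X : measurableType dX).
Context (lambda : {finite_measure set X -> \bar R}) (pi : X -> R) (nd : nat).
Context (Xs : 'I_nd -> set X) (q : X -> X -> R) (c C m cq : R).
Hypothesis mpi : measurable_fun setT pi.
Hypothesis pi1 : (\int[lambda]_x (pi x)%:E = 1)%E.
Hypothesis part : measurable_partition Xs.
Hypothesis c0 : 0 < c.
Hypothesis cpi : forall x, c <= pi x.
Hypothesis piC : forall x, pi x <= C.
Hypothesis m0 : 0 < m.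
Hypothesis mstar : forall i, m <= theta_star lambda pi Xs i.
Hypothesis mq : measurable_fun setT (fun z : X * X => q z.1 z.2).
Hypothesis q0 : forall x y, 0 <= q x y.
Hypothesis q1 : forall x, (\int[lambda]_y (q x y)%:E = 1)%E.
Hypothesis qC : forall x y, q x y = q y x.
Hypothesis cq0 : 0 < cq.
Hypothesis cqq : forall x y, cq <= q x y.

Let ts := theta_star lambda pi Xs.
Let acc := mh_accept lambda pi Xs.
Let pit := pi_theta lambda pi Xs.
Let Z (th : 'I_nd -> R) := \sum_(i < nd) ts i / th i.

(* The action of mh_kernel on functions: the rejection mass at x is absorbed in the
   increment g y - g x (see mh_kernelE). *)
Definition Pop (th : 'I_nd -> R) (g : X -> R) (x : X) : R :=
  g x + \int[lambda]_y (q x y * acc th x y * (g y - g x)).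

(* C / m bounds pi_theta uniformly in theta. *)
Definition rho : R := cq * m / C.

Let Xs_meas i : measurable (Xs i). Proof. by case: part. Qed.

Lemma partition_indic i j x : Xs i x -> \1_(Xs j) x = (j == i)%:R :> R.
Proof.
move=> xi; rewrite indicE; have [->|ji] := eqVneq j i; first by rewrite mem_set.
rewrite memNset// => xj.
by case: part => _ /(_ _ _ ji)/seteqP[h _] _; exact: (h x (conj xj xi)).
Qed.

Lemma partition_sum (F : 'I_nd -> R) i x : Xs i x ->
  \sum_(j < nd) F j * \1_(Xs j) x = F i.
Proof.
move=> xi; rewrite (bigD1 i)//= big1 ?addr0.
  by rewrite (partition_indic i xi) eqxx mulr1.
by move=> j ji; rewrite (partition_indic j xi) (negbTE ji) mulr0.
Qed.

Lemma Iof_eq i x : Xs i x -> Iof Xs x = Some i.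
Proof.
move=> xi; rewrite /Iof; case: pickP => [j /asboolP xj|/(_ i)]; last first.
  by move=> /asboolP.
congr Some; apply/eqP; apply: contrapT => /negP ji.
by case: part => _ /(_ _ _ ji)/seteqP[h _] _; exact: (h x (conj xj xi)).
Qed.

Let ts0 i : 0 < ts i. Proof. exact: lt_le_trans (mstar i). Qed.
Let pi0 x : 0 < pi x. Proof. exact: lt_le_trans (cpi x). Qed.
Let C0 : 0 < C. Proof. exact: lt_le_trans (lt_le_trans c0 (cpi point)) (piC point). Qed.

Section Theta.
Variable th : 'I_nd -> R.
Hypothesis Tth : in_Theta th.

Let th0 i : 0 < th i. Proof. by case: Tth => /(_ i)/andP[]. Qed.

Lemma Z_gt0 : 0 < Z th.
Proof.
have [i _] : exists i, Xs i point by case: part.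
rewrite /Z (bigD1 i)//= ltr_wpDr ?divr_gt0//.
by apply: sumr_ge0 => j _; rewrite divr_ge0// ltW.
Qed.

Lemma pi_thetaE i x : Xs i x -> pit th x = (Z th)^-1 * (pi x / th i).
Proof.
move=> xi; rewrite /pit /pi_theta; congr (_ * _).
exact: (partition_sum (fun j => pi x / th j) xi).
Qed.

Lemma pi_theta_gt0 x : 0 < pit th x.
Proof.
have [i xi] : exists i, Xs i x by case: part.
by rewrite (pi_thetaE xi) mulr_gt0 ?divr_gt0// invr_gt0 Z_gt0.
Qed.

(** [Z th * th i] contains the summand [ts i >= m], which bounds the normalization from below
    however small [th i] is. *)
Lemma pi_theta_le x : pit th x <= C / m.
Proof.
have [i xi] : exists i, Xs i x by case: part.
have Zi : m <= Z th * th i.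
  apply: le_trans (mstar i) _; rewrite /Z (bigD1 i)//= mulrDl divfK ?gt_eqF//.
  rewrite lerDl mulr_ge0 ?(ltW (th0 i))//.
  by apply: sumr_ge0 => j _; rewrite divr_ge0// ltW.
rewrite (pi_thetaE xi) mulrCA -invfM.
have Zt : 0 < Z th * th i by rewrite mulr_gt0 ?Z_gt0.
apply: ler_pM => //; first exact: ltW.
  by rewrite invr_ge0 ltW.
by rewrite lef_pV2.
Qed.

Lemma accE i j x y : Xs i x -> Xs j y ->
  acc th x y = Num.min 1 (pi y * th i / (pi x * th j)).
Proof.
move=> xi yj; rewrite /acc /mh_accept (pi_thetaE xi : pi_theta _ _ _ _ _ = _).
rewrite (pi_thetaE yj : pi_theta _ _ _ _ _ = _); congr Num.min.
by field; rewrite !gt_eqF// Z_gt0.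
Qed.

Lemma acc_ge0 x y : 0 <= acc th x y.
Proof.
rewrite /acc /mh_accept le_min ler01 /= divr_ge0//; exact/ltW/pi_theta_gt0.
Qed.

Lemma acc_le1 x y : acc th x y <= 1.
Proof. by rewrite /acc /mh_accept ge_min lexx. Qed.

(** Because [pit th <= C / m], both arguments of the minimum, 1 and [pit th y / pit th x], dominate
    [m / C * pit th y]. *)
Lemma acc_minor x y : rho * pit th y <= q x y * acc th x y.
Proof.
have -> : rho * pit th y = cq * (m / C * pit th y) by rewrite /rho; ring.
have mCp : m / C * pit th y <= 1.
  apply: (@le_trans _ _ (m / C * (C / m))).
    by rewrite ler_wpM2l ?pi_theta_le// divr_ge0// ltW.
  by have -> : m / C * (C / m) = 1 by field; rewrite !gt_eqF.
apply: ler_pM => //; first exact: ltW.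
  by rewrite mulr_ge0 ?divr_ge0 ?ltW// pi_theta_gt0.
rewrite /acc /mh_accept le_min mCp /= ler_pdivlMr ?pi_theta_gt0//.
have -> : m / C * pit th y * pit th x = pit th y * (m / C * pit th x) by ring.
rewrite -[leRHS]mulr1 ler_wpM2l ?(ltW (pi_theta_gt0 _))//.
apply: (@le_trans _ _ (m / C * (C / m))).
  by rewrite ler_wpM2l ?pi_theta_le// divr_ge0// ltW.
by have -> : m / C * (C / m) = 1 by field; rewrite !gt_eqF.
Qed.

Lemma detailed_balance x y :
  pit th x * (q x y * acc th x y) = pit th y * (q y x * acc th y x).
Proof.
have E u v : pit th u * acc th u v = Num.min (pit th u) (pit th v).
  rewrite /acc /mh_accept minr_pMr ?ltW ?pi_theta_gt0// mulr1.
  by rewrite mulrCA divff ?mulr1// gt_eqF// pi_theta_gt0.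
by rewrite mulrCA E [RHS]mulrCA E qC minC.
Qed.
End Theta.

Lemma acc_lipschitz th th' s : in_Theta th -> in_Theta th' -> 0 <= s ->
  (forall i, `|th' i - th i| <= s * th i) ->
  forall x y, `|acc th' x y - acc th x y| <= 4 * s.
Proof.
move=> T T' s0 close x y.
have [i xi] : exists i, Xs i x by case: part.
have [j yj] : exists i, Xs i y by case: part.
have th0 k : 0 < th k by case: T => /(_ k)/andP[].
have th'0 k : 0 < th' k by case: T' => /(_ k)/andP[].
rewrite (accE T xi yj) (accE T' xi yj).
have ratio k : 1 - s <= th' k / th k <= 1 + s.
  rewrite ler_pdivlMr// ler_pdivrMr//; have := close k.
  by rewrite ler_norml => /andP[? ?]; lra.
apply: (min1_lipschitz s0 _ _ (ratio i) (ratio j)).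
- by rewrite divr_ge0 ?mulr_ge0 ?ltW.
- by rewrite divr_ge0 ?mulr_ge0 ?ltW.
- by field; rewrite !gt_eqF.
Qed.

(** Theta is a measurable family over an arbitrary space: constant families give measurability at
    fixed theta, and [Omega] with the sigma-algebra F_n gives adaptedness. *)
Lemma measurable_pi_theta dT (T : measurableType dT) (th : T -> 'I_nd -> R) :
  (forall i, measurable_fun setT (fun t => th t i)) ->
  measurable_fun setT (fun z : T * X => pit (th z.1) z.2).
Proof.
move=> mth; rewrite /pit /pi_theta.
have mth1 i : measurable_fun setT (fun z : T * X => th z.1 i).
  exact: (measurableT_comp (mth i)).
apply: measurable_funM.
  apply: measurable_funV; apply: measurable_sum => i.
  by apply: measurable_funM => //; exact: measurable_funV.
apply: measurable_sum => i; apply: measurable_funM.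
  apply: measurable_funM; last exact: measurable_funV.
  exact: (measurableT_comp mpi).
by apply: (measurableT_comp _ measurable_snd); exact: measurable_indic.
Qed.

Lemma measurable_acc dT (T : measurableType dT) (th : T -> 'I_nd -> R) :
  (forall i, measurable_fun setT (fun t => th t i)) ->
  measurable_fun setT (fun z : (T * X) * X => acc (th z.1.1) z.1.2 z.2).
Proof.
move=> mth; have mp := measurable_pi_theta mth.
apply: measurable_minr; first exact: measurable_cst.
apply: measurable_funM.
  apply: (measurableT_comp mp (g := fun z : T * X * X => (z.1.1, z.2))).
  apply: measurable_fun_pair => //.
  exact: (measurableT_comp measurable_fst).
by apply: measurable_funV; exact: (measurableT_comp mp).
Qed.

Lemma measurable_Pop dT (T : measurableType dT) (th : T -> 'I_nd -> R) (G : T * X -> R) :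
  (forall i, measurable_fun setT (fun t => th t i)) -> measurable_fun setT G ->
  measurable_fun setT (fun z : T * X => Pop (th z.1) (fun y => G (z.1, y)) z.2).
Proof.
move=> mth mG; apply: measurable_funD.
  by under eq_fun do rewrite -surjective_pairing.
apply: (@measurable_fun_Rintegral _ _ _ _ _ lambda (fun z : T * X * X => q z.1.2 z.2 *
   acc (th z.1.1) z.1.2 z.2 * (G (z.1.1, z.2) - G (z.1.1, z.1.2)))).
apply: measurable_funM.
  apply: measurable_funM; last exact: measurable_acc.
  apply: (measurableT_comp mq (g := fun z : T * X * X => (z.1.2, z.2))).
  apply: measurable_fun_pair => //.
  exact: (measurableT_comp measurable_snd).
apply: measurable_funB; last first.
  apply: (measurableT_comp mG (g := fun z : T * X * X => (z.1.1, z.1.2))).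
  exact: (measurable_fun_pair (measurableT_comp measurable_fst measurable_fst)
    (measurableT_comp measurable_snd measurable_fst)).
apply: (measurableT_comp mG (g := fun z : T * X * X => (z.1.1, z.2))).
apply: measurable_fun_pair => //.
exact: (measurableT_comp measurable_fst).
Qed.

Let mqx x : measurable_fun setT (q x).
Proof. exact: (measurableT_comp mq (pair1_measurable x)). Qed.

Let macc th x : measurable_fun setT (acc th x).
Proof.
have := @measurable_acc _ X (fun=> th) (fun i => measurable_cst _).
by move=> /measurableT_comp/(_ (pair1_measurable (x, x))).
Qed.

Lemma measurable_Popx th g : measurable_fun setT g -> measurable_fun setT (Pop th g).
Proof.
move=> mg.
have := @measurable_Pop _ X (fun=> th) (fun z => g z.2) (fun i => measurable_cst _)
  (measurableT_comp mg measurable_snd).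
by move=> /measurableT_comp/(_ (measurable_fun_pair
  (@measurable_id _ _ setT) (@measurable_id _ _ setT))).
Qed.

Let mpit th : measurable_fun setT (pit th).
Proof.
have := @measurable_pi_theta _ X (fun=> th) (fun i => measurable_cst _).
by move=> /measurableT_comp/(_ (measurable_fun_pair
  (@measurable_id _ _ setT) (@measurable_id _ _ setT))).
Qed.

Lemma q_integrable x : lambda.-integrable setT (EFin \o q x).
Proof.
apply/integrableP; split; first exact/measurable_EFinP.
under eq_integral do rewrite /= ger0_norm//.
by rewrite q1 ltry.
Qed.

(** [q x] may be unbounded, so integrability against the kernel comes from domination by a multiple
    of this density. *)
Lemma q_dominated x (h : X -> R) (M : R) : measurable_fun setT h ->
  (forall y, `|h y| <= M * q x y) -> lambda.-integrable setT (EFin \o h).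
Proof.
move=> mh hM; apply: (@le_integrable _ _ _ _ _ _ _ (fun y => (M * q x y)%:E)) => //.
- exact/measurable_EFinP.
- by move=> y _; rewrite /= lee_fin (le_trans (hM y))// ler_norm.
- by apply: (integrableZl measurableT M (q_integrable x)).
Qed.

Lemma Rintegral_q x : \int[lambda]_y q x y = 1.
Proof. by rewrite /Rintegral q1. Qed.

(** * The kernel as an operator: contraction, invariance, stationary means *)

Section Operator.
Variable th : 'I_nd -> R.
Hypothesis Tth : in_Theta th.
Implicit Types (g h w : X -> R) (x : X) (M : R).

Let k x y := q x y * acc th x y.

Let mk x : measurable_fun setT (k x).
Proof. exact: measurable_funM. Qed.

Let k0 x y : 0 <= k x y.
Proof. by rewrite mulr_ge0// acc_ge0. Qed.

Let kq x y : k x y <= q x y.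
Proof. by rewrite -[leRHS]mulr1 ler_wpM2l// acc_le1. Qed.

Let k_int x : lambda.-integrable setT (EFin \o k x).
Proof.
by apply: (@q_dominated x _ 1) => // y; rewrite mul1r ger0_norm.
Qed.

Let kg_int x g : bmeas g -> lambda.-integrable setT (EFin \o (fun y => k x y * g y)).
Proof.
move=> [mg [M gM]]; apply: (@q_dominated x _ M); first exact: measurable_funM.
by move=> y; rewrite normrM mulrC (ger0_norm (k0 _ _)) ler_pM.
Qed.

Let PopE x g : bmeas g ->
  Pop th g x = g x * (1 - \int[lambda]_y k x y) + \int[lambda]_y (k x y * g y).
Proof.
move=> bg; rewrite /Pop.
have -> : \int[lambda]_y (q x y * acc th x y * (g y - g x)) =
    \int[lambda]_y (k x y * g y - k x y * g x).
  by apply: eq_Rintegral => y _; rewrite mulrBr.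
rewrite RintegralB//; [|exact: kg_int|exact: kg_int (bmeas_cst _ _)].
by rewrite RintegralZr//; ring.
Qed.

Lemma PopD g h x : bmeas g -> bmeas h ->
  Pop th (fun y => g y + h y) x = Pop th g x + Pop th h x.
Proof.
move=> bg bh; rewrite !PopE//; last exact: bmeasD.
have -> : \int[lambda]_y (k x y * (g y + h y)) =
    \int[lambda]_y (k x y * g y + k x y * h y).
  by apply: eq_Rintegral => y _; rewrite mulrDr.
by rewrite RintegralD//; [ring|exact: kg_int|exact: kg_int].
Qed.

Lemma PopZ r g x : bmeas g -> Pop th (fun y => r * g y) x = r * Pop th g x.
Proof.
move=> bg; rewrite !PopE//; last by apply: bmeasM => //; exact: bmeas_cst.
have -> : \int[lambda]_y (k x y * (r * g y)) =
    \int[lambda]_y (r * (k x y * g y)).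
  by apply: eq_Rintegral => y _; rewrite mulrCA.
by rewrite RintegralZl//; [ring|exact: kg_int].
Qed.

Lemma Pop_cst r x : Pop th (fun=> r) x = r.
Proof.
by rewrite PopE ?RintegralZr//; [ring|exact: bmeas_cst].
Qed.

Lemma PopB g h x : bmeas g -> bmeas h ->
  Pop th (fun y => g y - h y) x = Pop th g x - Pop th h x.
Proof.
move=> bg bh.
have -> : (fun y => g y - h y) = (fun y => g y + -1 * h y).
  by apply/funext => y; rewrite mulN1r.
rewrite PopD ?PopZ//; first by rewrite mulN1r.
by apply: bmeasM => //; exact: bmeas_cst.
Qed.

(* Splitting w off the kernel leaves total mass 1 - \int w acting on g. *)
Lemma Pop_minor g M w x : measurable_fun setT g -> (forall y, `|g y| <= M) ->
  measurable_fun setT w -> (forall y, 0 <= w y <= k x y) ->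
  \int[lambda]_y (w y * g y) = 0 ->
  `|Pop th g x| <= M * (1 - \int[lambda]_y w y).
Proof.
move=> mg gM mw wk wg0; have bg : bmeas g by split => //; exists M.
have w_int : lambda.-integrable setT (EFin \o w).
  apply: (@q_dominated x _ 1) => // y; have /andP[w0 wky] := wk y.
  by rewrite mul1r ger0_norm// (le_trans wky).
have M0 : 0 <= M by apply: le_trans (gM point).
have wg_int : lambda.-integrable setT (EFin \o (fun y => w y * g y)).
  apply: (@q_dominated x _ M); first exact: measurable_funM.
  move=> y; have /andP[w0 wky] := wk y.
  by rewrite normrM mulrC (ger0_norm w0) ler_pM// (le_trans wky).
have kw_int : lambda.-integrable setT (EFin \o (fun y => (k x y - w y) * g y)).
  have -> : EFin \o (fun y => (k x y - w y) * g y) =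
      ((EFin \o (fun y => k x y * g y)%R) \- (EFin \o (fun y => w y * g y)%R))%E.
    by apply/funext => y; rewrite /= mulrBl EFinB.
  by apply: integrableB => //; exact: kg_int.
have kwM_int : lambda.-integrable setT (EFin \o (fun y => (k x y - w y) * M)).
  have -> : EFin \o (fun y => (k x y - w y) * M) =
      ((EFin \o (fun y => k x y * M)%R) \- (EFin \o (fun y => w y * M)%R))%E.
    by apply/funext => y; rewrite /= mulrBl EFinB.
  apply: integrableB => //; first exact: kg_int (bmeas_cst _ _).
  apply: (@q_dominated x _ M); first exact: measurable_funM.
  move=> y; have /andP[w0 wky] := wk y.
  by rewrite normrM mulrC (ger0_norm w0) (ger0_norm M0) ler_pM// (le_trans wky).
have k1 : \int[lambda]_y k x y <= 1.
  by rewrite -(Rintegral_q x); apply: le_Rintegral => //; exact: q_integrable.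
rewrite PopE// -[X in _ + X]subr0 -wg0 -RintegralB//; last exact: kg_int.
have -> : \int[lambda]_y (k x y * g y - w y * g y) =
    \int[lambda]_y ((k x y - w y) * g y).
  by apply: eq_Rintegral => y _; rewrite mulrBl.
apply: le_trans (ler_normD _ _) _.
have -> : M * (1 - \int[lambda]_y w y) = M * (1 - \int[lambda]_y k x y) +
    \int[lambda]_y ((k x y - w y) * M).
  have -> : \int[lambda]_y ((k x y - w y) * M) =
      (\int[lambda]_y k x y - \int[lambda]_y w y) * M.
    rewrite -RintegralB// -RintegralZr//.
    by apply: (integrableB measurableT (k_int x) w_int).
  ring.
apply: lerD.
  by rewrite normrM [X in _ * X]ger0_norm ?subr_ge0// ler_wpM2r ?subr_ge0.
apply: le_trans (le_normr_Rintegral _ _) _ => //.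
apply: le_Rintegral => //; first exact: integrable_norm.
move=> y _; have /andP[w0 wky] := wk y.
by rewrite normrM ger0_norm ?subr_ge0// ler_wpM2l// subr_ge0.
Qed.

Lemma Pop_norm g M x : measurable_fun setT g -> (forall y, `|g y| <= M) ->
  `|Pop th g x| <= M.
Proof.
move=> mg gM; have := @Pop_minor g M (fun=> 0) x mg gM.
rewrite Rintegral_cst// mul0r subr0 mulr1; apply.
- exact: measurable_cst.
- by move=> y; rewrite lexx /=.
- by under eq_Rintegral do rewrite mul0r; rewrite Rintegral_cst// mul0r.
Qed.

Lemma bmeas_Pop g : bmeas g -> bmeas (Pop th g).
Proof.
move=> [mg [M gM]]; split; first exact: measurable_Popx.
by exists M => x; exact: Pop_norm.
Qed.

Lemma bmeas_pit : bmeas (pit th).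
Proof.
split=> //; exists (C / m) => x.
by rewrite ger0_norm ?pi_theta_le// ltW// pi_theta_gt0.
Qed.

Definition pint g := \int[lambda]_x (pit th x * g x).

(* Fubini and detailed balance for the nonnegative shift h = g + M. *)
Lemma pint_Pop g : bmeas g -> pint (Pop th g) = pint g.
Proof.
move=> bg; have [mg [M gM]] := bg.
have M0 : 0 <= M by apply: le_trans (gM point).
pose s x y := pit th x * k x y.
have bp := bmeas_pit.
have s0 x y : 0 <= s x y by rewrite mulr_ge0// ltW// pi_theta_gt0.
have sC x y : s x y = s y x by exact: detailed_balance.
have msg : measurable_fun setT (fun z : X * X => s z.1 z.2).
  apply: measurable_funM; first exact: (measurableT_comp (@mpit th)).
  apply: measurable_funM; first exact: mq.
  have := @measurable_acc _ X (fun=> th) (fun i => measurable_cst _).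
  move=> /measurableT_comp/(_ (measurable_fun_pair
    (measurable_fun_pair measurable_fst measurable_fst) measurable_snd)).
  exact.
pose h y := g y + M.
have h0 y : 0 <= h y by have := gM y; rewrite ler_norml /h => /andP[? _]; lra.
have bh : bmeas h by apply: bmeasD => //; exact: bmeas_cst.
have sh_int x : lambda.-integrable setT (EFin \o (fun y => pit th x * (k x y * h y))).
  exact: (integrableZl measurableT _ (kg_int x bh)).
have shx_int x : lambda.-integrable setT (EFin \o (fun y => pit th x * (k x y * h x))).
  exact: (integrableZl measurableT _ (kg_int x (bmeas_cst _ (h x)))).
have E : (\int[lambda]_x \int[lambda]_y (s x y * h y)%:E =
    \int[lambda]_x \int[lambda]_y (s x y * h x)%:E)%E.
  rewrite (@fubini_tonelli _ _ _ _ _ lambda lambda (fun z => (s z.1 z.2 * h z.2)%:E)).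
  - apply: eq_integral => y _; apply: eq_integral => x _ /=.
    by rewrite sC.
  - apply/measurable_EFinP; apply: measurable_funM => //.
    by apply: (measurableT_comp _ measurable_snd); case: bh.
  - by move=> z; rewrite lee_fin mulr_ge0.
have E1 x : (\int[lambda]_y (s x y * h y)%:E = (pit th x * \int[lambda]_y (k x y * h y))%:E)%E.
  rewrite -(RintegralZl _ measurableT (kg_int x bh)).
  rewrite /Rintegral fineK; last exact: (integrable_fin_num measurableT (sh_int x)).
  by apply: eq_integral => y _; rewrite /s mulrA.
have E2 x : (\int[lambda]_y (s x y * h x)%:E = (pit th x * (\int[lambda]_y k x y * h x))%:E)%E.
  rewrite -(RintegralZr _ measurableT (k_int x)).
  rewrite -(RintegralZl _ measurableT (kg_int x (bmeas_cst _ (h x)))).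
  rewrite /Rintegral fineK; last exact: (integrable_fin_num measurableT (shx_int x)).
  by apply: eq_integral => y _; rewrite /s mulrA.
have bPh := bmeas_Pop bh.
have PE x : \int[lambda]_y (k x y * h y) = Pop th h x - h x + \int[lambda]_y k x y * h x.
  by rewrite PopE//; ring.
have E3 : pint (Pop th h) = pint h.
  have bk1 : bmeas (fun x => \int[lambda]_y k x y).
    split.
      apply: (@measurable_fun_Rintegral _ _ _ _ _ lambda (fun z => k z.1 z.2)).
      apply: measurable_funM; first exact: mq.
      have := @measurable_acc _ X (fun=> th) (fun i => measurable_cst _).
      move=> /measurableT_comp/(_ (measurable_fun_pair
        (measurable_fun_pair measurable_fst measurable_fst) measurable_snd)).
      exact.
    exists 1 => x; rewrite ger0_norm; last by apply: Rintegral_ge0 => y _; exact: k0.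
    rewrite -(Rintegral_q x).
    by apply: (le_Rintegral measurableT (k_int x) (q_integrable x)) => y _; exact: kq.
  have bk := bmeasM bk1 bh.
  have : \int[lambda]_x (pit th x * \int[lambda]_y (k x y * h y)) =
      \int[lambda]_x (pit th x * (\int[lambda]_y k x y * h x)).
    rewrite /Rintegral; congr fine.
    transitivity (\int[lambda]_x \int[lambda]_y (s x y * h y)%:E)%E.
      by apply: eq_integral => x _; rewrite E1.
    by rewrite E; apply: eq_integral => x _; rewrite E2.
  under eq_Rintegral do rewrite PE mulrDr mulrBr.
  rewrite (bmeas_RintegralD _ (bmeasB (bmeasM bp bPh) (bmeasM bp bh)) (bmeasM bp bk)).
  rewrite (bmeas_RintegralB _ (bmeasM bp bPh) (bmeasM bp bh)).
  move/(canRL (addrK _)); rewrite subrr => /eqP; rewrite subr_eq0 => /eqP.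
  exact.
(* Back from [h] to [g]: the shift adds the same [M * pint (fun=> 1)] on both sides, which
   cancels. *)
have b1 := bmeasM bp (bmeas_cst X 1).
have bM1 := bmeasM (bmeas_cst X M) b1.
have bPg := bmeas_Pop bg.
have : pint (Pop th h) = pint (Pop th g) + M * pint (fun=> 1).
  rewrite /pint -(bmeas_RintegralZl _ _ b1) -(bmeas_RintegralD _ (bmeasM bp bPg) bM1).
  apply: eq_Rintegral => x _; rewrite (PopD _ bg (bmeas_cst _ M)).
  by rewrite Pop_cst; ring.
have : pint h = pint g + M * pint (fun=> 1).
  rewrite /pint -(bmeas_RintegralZl _ _ b1) -(bmeas_RintegralD _ (bmeasM bp bg) bM1).
  by apply: eq_Rintegral => x _; rewrite /h; ring.
rewrite E3 => ->; move/addIr; exact: esym.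
Qed.

Let bmeas_pi : bmeas pi.
Proof.
by split => //; exists C => x; rewrite ger0_norm// ltW.
Qed.

(** Independent of theta: through [pintE], the stationary mean depends on theta only via finitely
    many weights, which makes its continuity elementary. *)
Definition stratum g i := \int[lambda]_x (pi x * (g x * \1_(Xs i) x)).

Let bmeas_stratum g i : bmeas g -> bmeas (fun x => pi x * (g x * \1_(Xs i) x)).
Proof. by move=> bg; do 2 apply: bmeasM => //; exact: bmeas_indic. Qed.

Lemma pintE g : bmeas g ->
  pint g = (Z th)^-1 * \sum_(i < nd) (th i)^-1 * stratum g i.
Proof.
move=> bg; have bs i := bmeas_stratum i bg.
have bs' i : bmeas (fun x => (th i)^-1 * (pi x * (g x * \1_(Xs i) x))).
  by apply: bmeasM => //; exact: bmeas_cst.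
transitivity (\int[lambda]_x ((Z th)^-1 *
    \sum_(i < nd) (th i)^-1 * (pi x * (g x * \1_(Xs i) x)))).
  apply: eq_Rintegral => x _; rewrite /pit /pi_theta -mulrA; congr (_ * _).
  by rewrite mulr_suml; apply: eq_bigr => i _; ring.
rewrite bmeas_RintegralZl; last exact: bmeas_sum.
rewrite bmeas_Rintegral_sum//; congr (_ * _).
by apply: eq_bigr => i _; rewrite bmeas_RintegralZl.
Qed.

Lemma stratum_sum g : bmeas g ->
  \sum_(i < nd) stratum g i = \int[lambda]_x (g x * pi x).
Proof.
move=> bg; rewrite -bmeas_Rintegral_sum; last by move=> i; exact: bmeas_stratum.
apply: eq_Rintegral => x _.
have [i xi] : exists i, Xs i x by case: part.
by rewrite -mulr_sumr (partition_sum (fun=> g x) xi) mulrC.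
Qed.

Lemma stratum_indic i j : stratum \1_(Xs j) i = (i == j)%:R * ts i.
Proof.
rewrite /ts /theta_star /stratum -[X in _ = _ * X]/(Rintegral lambda (Xs i) pi).
rewrite [in RHS]Rintegral_mkcond -bmeas_RintegralZl; last first.
  have -> : pi \_ (Xs i) = (fun x => pi x * \1_(Xs i) x).
    by apply/funext => x; rewrite patchE indicE; case: ifP; rewrite ?mulr1 ?mulr0.
  by apply: bmeasM => //; exact: bmeas_indic.
apply: eq_Rintegral => x _; rewrite patchE.
have [l xl] : exists i, Xs i x by case: part.
rewrite !(partition_indic _ xl).
have [il|il] := eqVneq i l.
  by rewrite il mem_set// mulr1 eq_sym mulrC.
rewrite memNset ?mulr0// => xi.
by have := partition_indic i xl; rewrite (negbTE il) indicE mem_set// => /eqP; rewrite oner_eq0.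
Qed.

Lemma stratum1 i : stratum (fun=> 1) i = ts i.
Proof.
have := stratum_indic i i; rewrite eqxx mul1r => <-; rewrite /stratum.
by apply: eq_Rintegral => x _; rewrite mul1r indicE; case: (_ \in _); rewrite ?mulr1 ?mulr0.
Qed.

Lemma theta_star_sum1 : \sum_(i < nd) ts i = 1.
Proof.
under eq_bigr do rewrite -stratum1.
rewrite stratum_sum; last exact: bmeas_cst.
by under eq_Rintegral do rewrite mul1r; rewrite /Rintegral pi1.
Qed.

Lemma pint_cst r : pint (fun=> r) = r.
Proof.
have -> : pint (fun=> r) = r * pint (fun=> 1).
  rewrite /pint -bmeas_RintegralZl; last by apply: bmeasM; [exact: bmeas_pit|exact: bmeas_cst].
  by apply: eq_Rintegral => x _; rewrite mulr1 mulrC.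
rewrite pintE; last exact: bmeas_cst.
under eq_bigr do rewrite stratum1 mulrC.
by rewrite mulVf ?mulr1// gt_eqF// Z_gt0.
Qed.

Lemma pintB g h : bmeas g -> bmeas h -> pint (fun x => g x - h x) = pint g - pint h.
Proof.
move=> bg bh; rewrite /pint -bmeas_RintegralB; [|exact: (bmeasM bmeas_pit)..].
by apply: eq_Rintegral => x _; rewrite mulrBr.
Qed.

Lemma pint_norm g M : bmeas g -> (forall x, `|g x| <= M) -> `|pint g| <= M.
Proof.
move=> bg gM; have bp := bmeas_pit.
rewrite -(pint_cst M); apply: le_trans (le_normr_Rintegral _ _) _ => //.
  by apply: bmeas_integrable; exact: bmeasM.
apply: le_Rintegral => //.
- by apply: integrable_norm; apply: bmeas_integrable; exact: bmeasM.
- by apply: bmeas_integrable; apply: bmeasM => //; exact: bmeas_cst.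
- move=> x _; have p0 := ltW (pi_theta_gt0 Tth x).
  by rewrite normrM (ger0_norm p0) ler_wpM2l.
Qed.

Lemma rho_gt0 : 0 < rho. Proof. by rewrite divr_gt0// mulr_gt0. Qed.

Let rho_pint : \int[lambda]_y (rho * pit th y) = rho.
Proof.
rewrite bmeas_RintegralZl; last exact: bmeas_pit.
rewrite -[RHS]mulr1 -[in RHS](pint_cst 1) /pint.
by under [in RHS]eq_Rintegral do rewrite mulr1.
Qed.

Lemma rho_le1 : rho <= 1.
Proof.
rewrite -[leLHS]rho_pint -(Rintegral_q point); apply: le_Rintegral => //.
- by apply: bmeas_integrable; apply: bmeasM; [exact: bmeas_cst|exact: bmeas_pit].
- exact: q_integrable.
- by move=> y _; apply: le_trans (kq _ _); exact: acc_minor.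
Qed.

(** Doeblin contraction: the part [rho * pit th] split off the kernel integrates the centred
    function to 0, and mass [1 - rho] remains. *)
Lemma Pop_contract g M x : bmeas g -> (forall y, `|g y - pint g| <= M) ->
  `|Pop th g x - pint g| <= (1 - rho) * M.
Proof.
move=> bg gM; have bp := bmeas_pit.
have bg' : bmeas (fun y => g y - pint g) by apply: bmeasB => //; exact: bmeas_cst.
have := @Pop_minor (fun y => g y - pint g) M (fun y => rho * pit th y) x _ gM _ _ _.
rewrite rho_pint PopB//; last exact: bmeas_cst.
rewrite Pop_cst [M * _]mulrC; apply.
- by case: bg'.
- by apply: measurable_funM => //; case: bp.
- move=> y; rewrite acc_minor// andbT mulr_ge0//; first exact/ltW/rho_gt0.
  exact/ltW/pi_theta_gt0.
- under eq_Rintegral do rewrite -mulrA.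
  rewrite bmeas_RintegralZl; last exact: bmeasM.
  rewrite -/(pint _) pintB//; last exact: bmeas_cst.
  by rewrite pint_cst subrr mulr0.
Qed.

Lemma bmeas_iter_Pop K g : bmeas g -> bmeas (iter K (Pop th) g).
Proof. by move=> bg; elim: K => //= K IH; exact: bmeas_Pop. Qed.

Lemma pint_iter_Pop K g : bmeas g -> pint (iter K (Pop th) g) = pint g.
Proof.
by move=> bg; elim: K => //= K <-; rewrite pint_Pop//; exact: bmeas_iter_Pop.
Qed.

(** Invariance keeps the centre [pint g] fixed along the iteration; [2 * M] bounds the initial
    distance to it. *)
Lemma iter_Pop_cvg K g M x : bmeas g -> (forall y, `|g y| <= M) ->
  `|iter K (Pop th) g x - pint g| <= (1 - rho) ^+ K * (2 * M).
Proof.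
move=> bg gM; elim: K x => [|K IH] x /=.
  rewrite expr0 mul1r (le_trans (ler_normB _ _))//.
  have -> : 2 * M = M + M by ring.
  by rewrite lerD// pint_norm.
rewrite -(pint_iter_Pop K bg) exprS -mulrA; apply: Pop_contract.
  exact: bmeas_iter_Pop.
by move=> y; rewrite pint_iter_Pop.
Qed.

Lemma mh_kernelE x (A : set X) : measurable A ->
  mh_kernel lambda pi Xs q th x A = Pop th \1_A x.
Proof.
move=> mA; rewrite PopE; last exact: bmeas_indic.
rewrite /mh_kernel addrC; congr (_ + _).
rewrite -[LHS]/(Rintegral lambda A (k x)) [in LHS]Rintegral_mkcond.
apply: eq_Rintegral => y _; rewrite patchE indicE.
by case: ifP; rewrite ?mulr1 ?mulr0.
Qed.

(** Under pi_theta the stratum i has mass [ts i / (th i * Z th)], so the mean is the sum of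
    [(ts i - th i) * ts i / th i] divided by [Z th], and the [ts i] sum to 1. *)
Lemma pint_drift :
  pint (fun x => \sum_(i < nd) (ts i - th i) * \1_(Xs i) x) = chi2 ts th / Z th.
Proof.
have bi i := bmeas_indic R (Xs_meas i).
have bb i : bmeas (fun x => (ts i - th i) * \1_(Xs i) x).
  by apply: bmeasM => //; exact: bmeas_cst.
rewrite pintE; last exact: bmeas_sum.
rewrite mulrC; congr (_ * _).
rewrite /chi2 -theta_star_sum1 -sumrB; apply: eq_bigr => i _.
have -> : stratum (fun x => \sum_(i < nd) (ts i - th i) * \1_(Xs i) x) i =
    (ts i - th i) * stratum (fun=> 1) i.
  rewrite /stratum -bmeas_RintegralZl; last by apply: bmeas_stratum; exact: bmeas_cst.
  apply: eq_Rintegral => x _.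
  have [l xl] : exists i, Xs i x by case: part.
  rewrite (partition_sum (fun i => ts i - th i) xl) (partition_indic i xl).
  by case: eqVneq => [->|_]; rewrite ?mulr0//; ring.
by rewrite stratum1; field; rewrite gt_eqF//; case: Tth => /(_ i)/andP[].
Qed.
End Operator.

(** The 8 is 4 from [acc_lipschitz] times 2 from [g y - g x]; writing [Pop] with increments makes
    the rejection part vary along with the rest. *)
Lemma Pop_lipschitz (th th' : 'I_nd -> R) (s : R) (g : X -> R) (M : R) (x : X) :
  in_Theta th -> in_Theta th' -> 0 <= s ->
  (forall i, `|th' i - th i| <= s * th i) ->
  measurable_fun setT g -> (forall y, `|g y| <= M) ->
  `|Pop th' g x - Pop th g x| <= 8 * M * s.
Proof.
move=> T T' s0 close mg gM.
have gg y : `|g y - g x| <= 2 * M.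
  by rewrite (le_trans (ler_normB _ _))// mulr_natl mulr2n lerD.
have int t : in_Theta t ->
    lambda.-integrable setT (EFin \o (fun y => q x y * acc t x y * (g y - g x))).
  move=> Tt; apply: (@q_dominated x _ (2 * M)).
    by apply: measurable_funM; [exact: measurable_funM|exact: measurable_funB].
  move=> y; rewrite normrM mulrC; apply: ler_pM => //.
  rewrite normrM (ger0_norm (acc_ge0 Tt _ _)) ger0_norm//.
  by rewrite -[leRHS]mulr1 ler_wpM2l// acc_le1.
rewrite /Pop opprD addrACA subrr add0r -RintegralB//; [|exact: int..].
have int' := integrableB measurableT (int _ T') (int _ T).
apply: le_trans (le_normr_Rintegral _ _) _ => //.
have -> : 8 * M * s = \int[lambda]_y (4 * s * (2 * M) * q x y).
  rewrite RintegralZl//; last exact: q_integrable.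
  by rewrite Rintegral_q; ring.
apply: le_Rintegral => //.
- exact: integrable_norm.
- exact: (integrableZl measurableT (4 * s * (2 * M)) (q_integrable x)).
- move=> y _; rewrite -mulrBl -mulrBr !normrM ger0_norm//.
  have -> : 4 * s * (2 * M) * q x y = q x y * (4 * s) * (2 * M) by ring.
  by rewrite ler_pM// ?mulr_ge0// ler_wpM2l// acc_lipschitz.
Qed.

Lemma in_Theta_pos (t : 'I_nd -> R) : (2 <= nd)%N -> (forall i, 0 < t i) ->
  \sum_(i < nd) t i = 1 -> in_Theta t.
Proof.
move=> nd2 t0 t1; split=> // i.
rewrite t0 /= -t1 (bigD1 i)//= ltrDl.
have [j ji] : exists j : 'I_nd, j != i.
  pose a := Ordinal (ltnW nd2); pose b := Ordinal nd2.
  by have [E|?] := eqVneq a i; [exists b; rewrite -E|exists a].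
rewrite (bigD1 j)//= ltr_wpDr//; apply: sumr_ge0 => l _; exact: ltW.
Qed.

Lemma theta_star_in_Theta : (2 <= nd)%N -> in_Theta ts.
Proof. by move=> nd2; apply: in_Theta_pos => //; exact: theta_star_sum1. Qed.

Lemma theta_star_le1 i : ts i <= 1.
Proof.
rewrite -theta_star_sum1 (bigD1 i)//= lerDl.
by apply: sumr_ge0 => j _; exact: ltW.
Qed.

Lemma Z_theta_star : Z ts = nd%:R.
Proof.
rewrite /Z; under eq_bigr do rewrite divff ?gt_eqF//.
by rewrite sumr_const card_ord.
Qed.

(** At theta_star every stratum has mass 1/nd, and on stratum i the density is [pi / (nd * ts i)];
    the weight [nd * ts i] undoes this. Hence the factor d in the estimators. *)
Lemma pint_theta_star g : (2 <= nd)%N -> bmeas g ->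
  nd%:R * \sum_(i < nd) ts i * pint ts (fun x => g x * \1_(Xs i) x) =
  \int[lambda]_x (g x * pi x).
Proof.
move=> nd2 bg; have Ts := theta_star_in_Theta nd2.
rewrite -stratum_sum// mulr_sumr; apply: eq_bigr => i _.
rewrite pintE//; last by apply: bmeasM => //; exact: bmeas_indic.
rewrite (bigD1 i)//= big1 => [|j ji].
  have -> : stratum (fun x => g x * \1_(Xs i) x) i = stratum g i.
    apply: eq_Rintegral => x _; rewrite indicE.
    by case: (_ \in _); rewrite ?mulr1 ?mulr0.
  rewrite Z_theta_star addr0; field.
  by rewrite gt_eqF//= pnatr_eq0 -lt0n (leq_trans _ nd2).
rewrite [stratum _ _](_ : _ = 0) ?mulr0//.
transitivity (\int[lambda]_x (0 : R)); last by rewrite Rintegral_cst// mul0r.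
apply: eq_Rintegral => x _.
have [l xl] : exists i, Xs i x by case: part.
rewrite !(partition_indic _ xl).
case: (eqVneq i l) ji => [->|_ _]; last by rewrite !(mulr0,mul0r).
by move=> /negbTE ->; rewrite !mulr0.
Qed.

Lemma Pop_cvg (th : 'I_nd -> R) (gn : nat -> X -> R) (g : X -> R) (M : R) (x : X) : in_Theta th ->
  (forall j, measurable_fun setT (gn j)) -> measurable_fun setT g ->
  (forall j y, `|gn j y| <= M) -> (forall y, gn ^~ y @ \oo --> g y) ->
  (fun j => Pop th (gn j) x) @ \oo --> Pop th g x.
Proof.
move=> T mgn mg gM gcv; apply: cvgD; first exact: gcv.
have D j y : `|q x y * acc th x y * (gn j y - gn j x)| <= 2 * M * q x y.
  rewrite normrM mulrC; apply: ler_pM => //.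
    by rewrite (le_trans (ler_normB _ _))// mulr_natl mulr2n lerD.
  rewrite normrM (ger0_norm (acc_ge0 T _ _)) ger0_norm//.
  by rewrite -[leRHS]mulr1 ler_wpM2l// acc_le1.
have mh (h : X -> R) : measurable_fun setT h ->
    measurable_fun setT (fun y => q x y * acc th x y * (h y - h x)).
  by move=> mh; apply: measurable_funM; [exact: measurable_funM|exact: measurable_funB].
have := @dominated_convergence _ _ _ lambda setT measurableT
  (fun j y => (q x y * acc th x y * (gn j y - gn j x))%:E)
  (fun y => (q x y * acc th x y * (g y - g x))%:E) (fun y => (2 * M * q x y)%:E) _ _ _ _ _.
case.
- by move=> j; apply/measurable_EFinP; exact: mh.
- by apply/measurable_EFinP; exact: mh.
- apply: aeW => y _; apply: cvg_EFin; first exact: nearW.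
  by apply: cvgMr; apply: cvgB; exact: gcv.
- exact: (integrableZl measurableT (2 * M) (q_integrable x)).
- by apply: aeW => y j _; rewrite /= lee_fin.
move=> int _ h2; apply: fine_cvg; rewrite /Rintegral fineK//.
exact: integrable_fin_num.
Qed.

Lemma pint_cvg (tn : nat -> 'I_nd -> R) (t : 'I_nd -> R) (g : X -> R) :
  (forall n, in_Theta (tn n)) ->
  in_Theta t -> (forall i, (fun n => tn n i) @ \oo --> t i) -> bmeas g ->
  (fun n => pint (tn n) g) @ \oo --> pint t g.
Proof.
move=> Tn T tcv bg; rewrite pintE//.
have -> : (fun n => pint (tn n) g) = (fun n => (Z (tn n))^-1 *
    \sum_(i < nd) (tn n i)^-1 * stratum g i).
  by apply/funext => n; rewrite pintE.
have t0 i : t i != 0 by rewrite gt_eqF//; case: T => /(_ i)/andP[].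
apply: cvgM.
  apply: cvgV; first by rewrite gt_eqF// Z_gt0.
  by apply: sum_cvg => i; apply: cvgMr; apply: cvgV.
by apply: sum_cvg => i; apply: cvgMl; apply: cvgV.
Qed.

(** * The Wang-Landau chain and its filtration *)

Context (dO : measure_display) (Omega : measurableType dO) (P : probability Omega R).
Context (Xn : nat -> Omega -> X) (theta : nat -> Omega -> 'I_nd -> R) (gamma : R ^nat).
Hypothesis nd2 : (2 <= nd)%N.
Hypothesis gamma01 : forall n, 0 <= gamma n.+1 < 1.
Hypothesis mXn : forall n, measurable_fun setT (Xn n).
Hypothesis mth0 : forall i, measurable_fun setT (fun w => theta 0%N w i).
Hypothesis Tth0 : forall w, in_Theta (theta 0%N w).
Hypothesis thS : forall n w i,
  theta n.+1 w i = theta n w i + gamma n.+1 * Hwl Xs (Xn n.+1 w) (theta n w) i.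
Hypothesis trans : forall n (B : set Omega) (A : set X),
  WL_filtration (theta 0%N) Xn n B -> measurable A ->
  P (B `&` Xn n.+1 @^-1` A) =
    (\int[P]_(w in B) (mh_kernel lambda pi Xs q (theta n w) (Xn n w) A)%:E)%E.

(** Generators only, so that [adapted WL_gen n] is measurability with respect to [WL_filtration] at
    time n. *)
Definition WL_gen n : set (set Omega) :=
  [set B | (exists i (C : set R), measurable C /\ B = (fun w => theta 0%N w i) @^-1` C)
        \/ (exists k (A : set X), [/\ (k <= n)%N, measurable A & B = Xn k @^-1` A])].

Lemma WL_gen_measurable n : WL_gen n `<=` measurable.
Proof.
move=> B [[i [D [mD ->]]]|[k [A [_ mA ->]]]]; rewrite -[X in measurable X]setTI.
  exact: mth0.
exact: mXn.
Qed.

Lemma WL_gen_incr n : WL_gen n `<=` WL_gen n.+1.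
Proof.
move=> B [h|[k [A [kn mA ->]]]]; [by left|right].
by exists k, A; split => //; exact: leqW.
Qed.

Lemma thetaIE (t : 'I_nd -> R) i x : Xs i x -> thetaI Xs t x = t i.
Proof. by move=> xi; rewrite /thetaI (Iof_eq xi). Qed.

Lemma thetaI_sum (t : 'I_nd -> R) x : thetaI Xs t x = \sum_(i < nd) t i * \1_(Xs i) x.
Proof.
have [i xi] : exists i, Xs i x by case: part.
by rewrite (thetaIE t xi) (partition_sum t xi).
Qed.

Lemma thS_mul n w i : theta n.+1 w i = theta n w i *
  (1 + gamma n.+1 * (\1_(Xs i) (Xn n.+1 w) - thetaI Xs (theta n w) (Xn n.+1 w))).
Proof. by rewrite thS /Hwl; ring. Qed.

Lemma thetaI_itv (t : 'I_nd -> R) x : in_Theta t -> 0 < thetaI Xs t x < 1.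
Proof.
have [i xi] : exists i, Xs i x by case: part.
by rewrite (thetaIE t xi) => -[].
Qed.

(** [gamma < 1] and [thetaI < 1] keep the multiplicative factor positive; the total is preserved
    because [thetaI] is the theta-weighted sum of the indicators. *)
Lemma theta_in_Theta n w : in_Theta (theta n w).
Proof.
elim: n => [//|n IH]; apply: in_Theta_pos => // [i|].
  rewrite thS_mul; have /andP[g0 g1] := gamma01 n.
  have /andP[t0 t1] := thetaI_itv (Xn n.+1 w) IH.
  apply: mulr_gt0; first by case: IH => /(_ i)/andP[].
  have b0 : 0 <= \1_(Xs i) (Xn n.+1 w) :> R by rewrite indicE.
  by move: (\1_ _ _) b0 => b b0; nra.
under eq_bigr do rewrite thS /Hwl.
rewrite big_split/= -mulr_sumr; have [_ s1] := IH.
rewrite s1 -[RHS]addr0; congr (_ + _).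
under eq_bigr do rewrite mulrBr.
by rewrite sumrB -mulr_suml s1 mul1r -thetaI_sum subrr mulr0.
Qed.

Lemma theta_close n w i :
  `|theta n.+1 w i - theta n w i| <= gamma n.+1 * theta n w i.
Proof.
have /andP[g0 _] := gamma01 n; have T := theta_in_Theta n w.
have /andP[t0 t1] := thetaI_itv (Xn n.+1 w) T.
have ti : 0 < theta n w i by case: T => /(_ i)/andP[].
have -> : theta n.+1 w i - theta n w i = gamma n.+1 * theta n w i *
    (\1_(Xs i) (Xn n.+1 w) - thetaI Xs (theta n w) (Xn n.+1 w)).
  by rewrite thS_mul; ring.
rewrite normrM ger0_norm ?mulr_ge0// ?(ltW ti)//.
rewrite -[leRHS]mulr1 ler_wpM2l// ?mulr_ge0// ?(ltW ti)//.
by rewrite ler_norml indicE; case: (_ \in _) => /=; lra.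
Qed.

Lemma Xn_adapted k n : (k <= n)%N -> adapted WL_gen n (Xn k).
Proof.
move=> kn _ A mA; rewrite setTI; apply: sub_sigma_algebra.
by right; exists k, A.
Qed.

Lemma theta_adapted n i : adapted WL_gen n (fun w => theta n w i).
Proof.
elim: n i => [|n IH] i.
  by move=> _ D mD; rewrite setTI; apply: sub_sigma_algebra; left; exists i, D.
have IH' j := adaptedW WL_gen_incr (leqnSn n) (IH j).
have mI j : adapted WL_gen n.+1 (fun w => \1_(Xs j) (Xn n.+1 w) : R).
  apply: (measurableT_comp (measurable_indic (Xs_meas j))).
  exact: Xn_adapted.
have -> : (fun w => theta n.+1 w i) = (fun w => theta n w i * (1 + gamma n.+1 *
    (\1_(Xs i) (Xn n.+1 w) - \sum_(j < nd) theta n w j * \1_(Xs j) (Xn n.+1 w)))).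
  by apply/funext => w; rewrite thS_mul thetaI_sum.
apply: measurable_funM; first exact: IH'.
apply: measurable_funD; first exact: measurable_cst.
apply: measurable_funM; first exact: measurable_cst.
apply: measurable_funB; first exact: mI.
by apply: measurable_sum => j; apply: measurable_funM; [exact: IH'|exact: mI].
Qed.

(** * From transition probabilities of events to integrals of functions *)

Section Freezing.
Variable n : nat.
Let On := g_sigma_algebraType (WL_gen n).
Implicit Types (G H : On * X -> R).

Let next G (w : Omega) := G (w, Xn n.+1 w).
Let cond G (w : Omega) := Pop (theta n w) (fun y => G (w, y)) (Xn n w).

Let bmeas_next G : bmeas G -> bmeas (next G).
Proof.
move=> [mG [M GM]]; split; last by exists M => w; exact: GM.
apply: (measurableT_comp mG (g := fun w : Omega => (w : On, Xn n.+1 w))).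
apply: measurable_fun_pair; last exact: mXn.
move=> _ A mA; rewrite setTI.
by move: A mA; apply: smallest_sub; [exact: sigma_algebra_measurable|exact: WL_gen_measurable].
Qed.

Let bmeas_sec G w : bmeas G -> bmeas (fun y => G (w, y)).
Proof.
move=> [mG [M GM]]; split; last by exists M.
exact: (measurableT_comp mG (pair1_measurable w)).
Qed.

Lemma cond_adapted G : bmeas G -> adapted WL_gen n (cond G).
Proof.
move=> [mG _].
have mP := measurable_Pop (th := fun w : On => theta n w) (@theta_adapted n) mG.
apply: (measurableT_comp mP (g := fun w : On => (w, Xn n w))).
by apply: measurable_fun_pair => //; exact: Xn_adapted.
Qed.

Let bmeas_cond G : bmeas G -> bmeas (cond G).
Proof.
move=> bG; split.
  exact: (adapted_measurable WL_gen_measurable (@cond_adapted G bG)).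
have [_ [M GM]] := bG; exists M => w.
by apply: Pop_norm; [exact: theta_in_Theta|case: (bmeas_sec w bG)|].
Qed.

(* The class of G satisfying the claim, closed under bounded pointwise limits. *)
Let fz G := bmeas G /\ \int[P]_w next G w = \int[P]_w cond G w.

Let fz_add G H : fz G -> fz H -> fz (fun z => G z + H z).
Proof.
move=> [bG eG] [bH eH]; split; first exact: bmeasD.
rewrite /next /cond bmeas_RintegralD; [|exact: bmeas_next..].
rewrite eG eH -bmeas_RintegralD; [|exact: bmeas_cond..].
apply: eq_Rintegral => w _; rewrite PopD//; first exact: theta_in_Theta.
- exact: bmeas_sec bG.
- exact: bmeas_sec bH.
Qed.

Let fz_scale r G : fz G -> fz (fun z => r * G z).
Proof.
move=> [bG eG]; split; first by apply: bmeasM => //; exact: bmeas_cst.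
rewrite /next /cond bmeas_RintegralZl; last exact: bmeas_next.
rewrite eG -bmeas_RintegralZl; last exact: bmeas_cond.
apply: eq_Rintegral => w _; rewrite PopZ//; first exact: theta_in_Theta.
exact: bmeas_sec bG.
Qed.

Let fz_cst r : fz (fun=> r).
Proof.
split; first exact: bmeas_cst.
apply: eq_Rintegral => w _; rewrite /next /cond Pop_cst//.
exact: theta_in_Theta.
Qed.

Let fz_lim (Gn : nat -> On * X -> R) G M : (forall j, fz (Gn j)) ->
  (forall j z, `|Gn j z| <= M) -> (forall z, Gn ^~ z @ \oo --> G z) -> fz G.
Proof.
move=> fGn GM Gcv.
have mGn j : measurable_fun setT (Gn j) by case: (fGn j) => -[].
have bG : bmeas G.
  split; first by apply: (measurable_fun_cvg mGn) => z _; exact: Gcv.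
  exists M => z; have h : (fun j => `|Gn j z|) @ \oo --> `|G z|.
    exact: cvg_norm (Gcv z).
  rewrite -(cvg_lim _ h)//; apply: limr_le; first by apply/cvg_ex; exists `|G z|.
  by apply: nearW => j.
split => //.
have h1 : (fun j => \int[P]_w next (Gn j) w) @ \oo --> \int[P]_w next G w.
  apply: (@bmeas_cvg_Rintegral _ _ _ P (fun j => next (Gn j)) _ M).
  - by move=> j; case: (bmeas_next (fGn j).1).
  - by case: (bmeas_next bG).
  - by move=> j w; exact: GM.
  - by apply: aeW => w; exact: Gcv.
have h2 : (fun j => \int[P]_w cond (Gn j) w) @ \oo --> \int[P]_w cond G w.
  apply: (@bmeas_cvg_Rintegral _ _ _ P (fun j => cond (Gn j)) _ M).
  - by move=> j; case: (bmeas_cond (fGn j).1).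
  - by case: (bmeas_cond bG).
  - move=> j w; apply: Pop_norm; first exact: theta_in_Theta.
      by case: (bmeas_sec w (fGn j).1).
    by move=> y; exact: GM.
  - apply: aeW => w; apply: (@Pop_cvg _ _ _ M) => //.
    + exact: theta_in_Theta.
    + by move=> j; case: (bmeas_sec w (fGn j).1).
    + by case: (bmeas_sec w bG).
have E : (fun j => \int[P]_w next (Gn j) w) = (fun j => \int[P]_w cond (Gn j) w).
  by apply/funext => j; case: (fGn j).
by rewrite -(cvg_lim _ h1)// -(cvg_lim _ h2)// E.
Qed.

(** The base case is the hypothesis [trans], with [mh_kernel] read as [Pop] of an indicator. *)
Let fz_rect (B : set On) (A : set X) : measurable B -> measurable A ->
  fz \1_(B `*` A).
Proof.
move=> mB mA; split; first by apply: bmeas_indic; exact: measurableX.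
have mB' : measurable (B : set Omega).
  by move: B mB; apply: smallest_sub; [exact: sigma_algebra_measurable|exact: WL_gen_measurable].
have mXA : measurable (Xn n.+1 @^-1` A) by rewrite -[X in measurable X]setTI; exact: mXn.
have IE w y : \1_(B `*` A) (w, y) = \1_B w * \1_A y :> R.
  by rewrite !indicE in_setX; case: (_ \in _); case: (_ \in _); rewrite ?mulr1 ?mulr0.
transitivity (fine (P ((B : set Omega) `&` Xn n.+1 @^-1` A))).
  have bI := bmeas_indic R (measurableI _ _ mB' mXA).
  transitivity (\int[P]_w \1_((B : set Omega) `&` Xn n.+1 @^-1` A) w).
    apply: eq_Rintegral => w _; rewrite /next IE !indicE in_setI.
    have -> : (w \in Xn n.+1 @^-1` A) = (Xn n.+1 w \in A) by apply/idP/idP; rewrite !inE.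
    by case: (_ \in _); case: (_ \in _); rewrite ?mulr1 ?mulr0.
  by rewrite /Rintegral integral_indic ?setIT//; exact: measurableI.
rewrite trans//.
transitivity (\int[P]_(w in (B : set Omega)) Pop (theta n w) \1_A (Xn n w)).
  apply: eq_Rintegral => w _; rewrite mh_kernelE//; exact: theta_in_Theta.
rewrite Rintegral_mkcond; apply: eq_Rintegral => w _; rewrite patchE /cond.
under [in RHS]eq_fun do rewrite IE.
rewrite PopZ; [|exact: theta_in_Theta|exact: bmeas_indic].
by rewrite indicE; case: ifP => _; rewrite ?mul1r ?mul0r.
Qed.

Let fz_set (S : set (On * X)) : measurable S -> fz \1_S.
Proof.
move=> mS; have mS' := mS; rewrite measurable_prod_measurableType in mS'.
move: S mS' {mS}; apply: dynkin_induction.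
- exact: measurable_prod_measurableType.
- move=> _ _ [B1 mB1 [A1 mA1 <-]] [B2 mB2 [A2 mA2 <-]].
  exists (B1 `&` B2); first exact: measurableI.
  by exists (A1 `&` A2); [exact: measurableI|rewrite setXI].
- have -> : (\1_[set: On * X] : On * X -> R) = fun=> 1.
    by apply/funext => z; rewrite indicT.
  exact: fz_cst.
- by move=> _ [B mB [A mA <-]]; exact: fz_rect.
- move=> S mS fS.
  have -> : (\1_(~` S) : On * X -> R) = (fun z => 1 + -1 * \1_S z).
    apply/funext => z; rewrite !indicE in_setC.
    by case: (_ \in _) => /=; ring.
  by apply: fz_add; [exact: fz_cst|exact: fz_scale].
- move=> F mF tF fF.
  (* Disjointness keeps all partial sums of indicators in {0, 1}, which is the uniform bound that
     [fz_lim] requires. *)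
  have sum1 k z : F k z -> forall j, \sum_(0 <= i < j) \1_(F i) z = (k < j)%:R :> R.
    move=> Fk; have FE i : \1_(F i) z = (i == k)%:R :> R.
      rewrite indicE; have [->|ik] := eqVneq i k; first by rewrite mem_set.
      rewrite memNset// => Fi; move/eqP: ik; apply.
      by apply: tF => //; exists z.
    elim=> [|j IH]; first by rewrite big_geq.
    rewrite big_nat_recr//= IH FE ltnS [in RHS]leq_eqVlt [j == k]eq_sym.
    by case: ltngtP => _ /=; rewrite ?addr0 ?add0r.
  have sum0 z : ~ (\bigcup_k F k) z -> forall j, \sum_(0 <= i < j) \1_(F i) z = 0 :> R.
    move=> nF j; apply: big1 => i _; rewrite indicE memNset// => Fi.
    by apply: nF; exists i.
  apply: (@fz_lim (fun j z => \sum_(0 <= k < j) \1_(F k) z) _ 1).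
  + elim=> [|j IH]; first by under eq_fun do rewrite big_geq//; exact: fz_cst.
    by under eq_fun do rewrite big_nat_recr//=; exact: fz_add IH (fF j).
  + move=> j z; have [[k _ Fk]|nF] := pselect ((\bigcup_k F k) z).
      by rewrite (sum1 k z Fk); case: (k < j)%N; rewrite ?normr1 ?normr0.
    by rewrite sum0// normr0.
  + move=> z; have [[k _ Fk]|nF] := pselect ((\bigcup_k F k) z).
      apply: cvg_near_cst; exists k.+1 => // j /= kj.
      by rewrite (sum1 k z Fk) kj indicE mem_set//; exists k.
    rewrite indicE memNset//; under eq_fun do rewrite sum0//.
    exact: cvg_cst.
Qed.

Import HBNNSimple.

(** The first coordinate carries F_n, so [G] may involve theta_n, X_n and any test variable while
    only X_{n+1} is averaged; this identity takes the place of conditional expectation. *)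
Lemma freezing G : bmeas G ->
  \int[P]_w G (w, Xn n.+1 w) = \int[P]_w Pop (theta n w) (fun y => G (w, y)) (Xn n w).
Proof.
move=> bG; suff : fz G by case.
(* The shift by [M] gives a nonnegative function, which is an increasing limit of simple ones. *)
have [mG [M GM]] := bG; pose H z := G z + M.
have H0 z : 0 <= H z by have := GM z; rewrite ler_norml /H => /andP[? _]; lra.
suff fH : fz H.
  have -> : G = (fun z => H z + - M) by apply/funext => z; rewrite /H addrK.
  exact: fz_add fH (fz_cst _).
have mH : measurable_fun setT (EFin \o H).
  by apply/measurable_EFinP; apply: measurable_funD.
pose h := nnsfun_approx measurableT mH.
have hcv z : (fun j => h j z) @ \oo --> H z.
  have := @cvg_nnsfun_approx _ _ _ _ measurableT _ mH _ z I.
  by move=> /(_ _)/fine_cvg; apply => ? _; rewrite lee_fin.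
have hnd z : {homo (fun j => h j z) : a b / (a <= b)%N >-> a <= b}.
  by move=> a b ab; have := @nd_nnsfun_approx _ _ _ _ measurableT _ mH a b ab => /lefP/(_ z).
have hle j z : `|h j z| <= 2 * M.
  rewrite ger0_norm//; apply: (@le_trans _ _ (H z)); last first.
    by have := GM z; rewrite ler_norml /H => /andP[_ ?]; lra.
  by have := nondecreasing_cvgn_le (hnd z) (cvgP _ (hcv z)) j; rewrite (cvg_lim _ (hcv z)).
apply: (@fz_lim (fun j z => h j z) _ (2 * M)) => // j.
have -> : (fun z => h j z) = (fun z => \sum_(y <- finmap.enum_fset (fset_set (range (h j))))
    y * \1_(h j @^-1` [set y]) z).
  by apply/funext => z; rewrite fimfunE fsbig_finite.
elim: (finmap.enum_fset _) => [|y s IH].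
  by under eq_fun do rewrite big_nil; exact: fz_cst.
under eq_fun do rewrite big_cons.
apply: (fz_add (fz_scale y (fz_set _)) IH).
exact: measurable_sfunP.
Qed.
End Freezing.

(* L is a Lipschitz constant for the relative variation of theta, which is what an
   update of theta controls. *)
Definition lip_family (g : ('I_nd -> R) -> X -> R) (M L : R) :=
  [/\ forall dT (T : measurableType dT) (th : T -> 'I_nd -> R),
        (forall i, measurable_fun setT (fun t => th t i)) ->
        measurable_fun setT (fun z : T * X => g (th z.1) z.2),
      forall th x, in_Theta th -> `|g th x| <= M &
      forall th th' (s : R) x, in_Theta th -> in_Theta th' -> 0 <= s ->
        (forall i, `|th' i - th i| <= s * th i) -> `|g th' x - g th x| <= L * s].

Lemma family_bmeas g M L th : lip_family g M L -> in_Theta th -> bmeas (g th).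
Proof.
move=> [mg gM _] T; split; last by exists M => x; exact: gM.
have := mg _ X (fun=> th) (fun i => measurable_cst _).
by move=> /measurableT_comp/(_ (measurable_fun_pair
  (@measurable_id _ _ setT) (@measurable_id _ _ setT))).
Qed.

(** [Pop th'] applied to [g th' - g th] costs [L], and the change of kernel on the fixed function
    [g th] costs [8 * M]. *)
Lemma family_Pop g M L : lip_family g M L -> lip_family (fun th => Pop th (g th)) M (L + 8 * M).
Proof.
move=> fg; have [mg gM gL] := fg; split.
- by move=> dT T th mth; exact: (measurable_Pop mth (mg _ _ _ mth)).
- by move=> th x T; apply: Pop_norm => // [|y]; [case: (family_bmeas fg T)|exact: gM].
- move=> th th' s x T T' s0 close.
  have b := family_bmeas fg T; have b' := family_bmeas fg T'.
  have -> : Pop th' (g th') x - Pop th (g th) x =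
      Pop th' (fun y => g th' y - g th y) x + (Pop th' (g th) x - Pop th (g th) x).
    by rewrite PopB//; ring.
  rewrite mulrDl (le_trans (ler_normD _ _))// lerD//.
    apply: Pop_norm => // [|y]; last exact: gL.
    by case: (bmeasB b' b).
  apply: Pop_lipschitz => //; first by case: b.
  by move=> y; exact: gM.
Qed.

Lemma family_iter g M L K : lip_family g M L ->
  lip_family (fun th => iter K (Pop th) (g th)) M (L + K%:R * (8 * M)).
Proof.
move=> fg; elim: K => [|K IH]; first by rewrite mul0r addr0.
by rewrite -natr1 mulrDl mul1r addrA; exact: (family_Pop IH).
Qed.

(** * Convergence of weighted Poisson-type series *)

Section PoissonSeries.
Variable a : R ^nat.
Hypothesis a0 : forall n, 0 <= a n.
Hypothesis adec : forall n, a n.+1 <= a n.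
Hypothesis acvg : a @ \oo --> 0.
Hypothesis asqr : cvgn (series (fun n => a n ^+ 2)).
Hypothesis agam : cvgn (series (fun n => a n * gamma n.+1)).

(* With U = P g, each term is the martingale increment g(X') - U(X) plus U(X) - U(X'),
   and the latter telescopes up to the variation of U with theta. *)
Lemma ae_cvg_series_increment g M L : lip_family g M L ->
  {ae P, forall w, cvgn (series (fun n => a n *
    (g (theta n w) (Xn n.+1 w) - Pop (theta n w) (g (theta n w)) (Xn n.+1 w))))}.
Proof.
move=> fg; have [mg gM _] := fg; have [_ UM UL] := family_Pop fg.
pose G n (z : g_sigma_algebraType (WL_gen n) * X) := g (theta n z.1) z.2.
have bG n : bmeas (G n).
  split; last by exists M => z; apply: gM; exact: theta_in_Theta.
  exact: (mg _ _ (fun w : g_sigma_algebraType (WL_gen n) => theta n w) (@theta_adapted n)).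
have T n w := theta_in_Theta n w.
have M0 : 0 <= M by apply: le_trans (gM _ point (T 0%N point)).
pose U n w := Pop (theta n w) (g (theta n w)) (Xn n w).
pose xi n w := a n * (g (theta n w) (Xn n.+1 w) - U n w).
have U_adapted n : adapted WL_gen n (U n) by exact: (@cond_adapted n (G n) (bG n)).
have g_adapted n : adapted WL_gen n.+1 (fun w => g (theta n w) (Xn n.+1 w)).
  have m1 := mg _ _ (fun w : g_sigma_algebraType (WL_gen n.+1) => theta n w)
    (fun i => adaptedW WL_gen_incr (leqnSn n) (@theta_adapted n i)).
  apply: (measurableT_comp m1 (g := fun w : g_sigma_algebraType (WL_gen n.+1) => (w, Xn n.+1 w))).
  by apply: measurable_fun_pair => //; exact: Xn_adapted.
have xi_adapted n : adapted WL_gen n.+1 (xi n).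
  apply: measurable_funM; first exact: measurable_cst.
  apply: measurable_funB; first exact: g_adapted.
  exact: (adaptedW WL_gen_incr (leqnSn n) (@U_adapted n)).
have xi_le n w : `|xi n w| <= a n * (2 * M).
  rewrite normrM ger0_norm// ler_wpM2l// (le_trans (ler_normB _ _))//.
  by rewrite mulr_natl mulr2n lerD ?gM ?UM.
have xi_mdiff : martingale_diff P WL_gen xi.
  move=> n Y aY [N YN].
  (* Absorbing the test variable [Y] into the integrand makes the martingale property an instance of
     [freezing]. *)
  pose H (z : g_sigma_algebraType (WL_gen n) * X) := (a n * Y z.1) * G n z.
  have bY : bmeas (fun z : g_sigma_algebraType (WL_gen n) * X => a n * Y z.1).
    apply: bmeasM; first exact: bmeas_cst.
    split; first exact: (measurableT_comp aY measurable_fst).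
    by exists N => z; exact: YN.
  have bYO : bmeas (fun w => a n * Y w).
    apply: bmeasM; first exact: bmeas_cst.
    by split; [exact: (adapted_measurable WL_gen_measurable aY)|exists N].
  have bH : bmeas H by exact: bmeasM.
  have fr := freezing bH.
  have bg1 : bmeas (fun w => g (theta n w) (Xn n.+1 w)).
    split; first exact: (adapted_measurable WL_gen_measurable (@g_adapted n)).
    by exists M => w; exact: gM.
  have bU : bmeas (U n).
    split; first exact: (adapted_measurable WL_gen_measurable (@U_adapted n)).
    by exists M => w; exact: UM.
  transitivity (\int[P]_w ((a n * Y w) * g (theta n w) (Xn n.+1 w) - (a n * Y w) * U n w)).
    by apply: eq_Rintegral => w _; rewrite /xi; ring.
  rewrite (bmeas_RintegralB _ (bmeasM bYO bg1) (bmeasM bYO bU)).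
  rewrite (fr : \int[P]_w (a n * Y w * g (theta n w) (Xn n.+1 w)) = _).
  apply/eqP; rewrite subr_eq0; apply/eqP; apply: eq_Rintegral => w _.
  by rewrite /H /G /= PopZ//; exact: (family_bmeas fg).
have csqr : cvgn (series (fun n => (a n * (2 * M)) ^+ 2)).
  have -> : (fun n => (a n * (2 * M)) ^+ 2) = ((2 * M) ^+ 2) *: (fun n => a n ^+ 2).
    by apply/funext => n; rewrite exprMn mulrC.
  exact: is_cvg_seriesZ.
have := martingale_series_cvg WL_gen_measurable WL_gen_incr xi_adapted xi_le xi_mdiff csqr.
apply: filterS => w xicv.
have -> : (fun n => a n * (g (theta n w) (Xn n.+1 w) -
      Pop (theta n w) (g (theta n w)) (Xn n.+1 w))) =
    (fun n => xi n w) + ((fun n => a n * (U n w - U n.+1 w)) +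
    (fun n => a n * (U n.+1 w - Pop (theta n w) (g (theta n w)) (Xn n.+1 w)))).
  by apply/funext => n; rewrite !fctE /xi; ring.
apply: is_cvg_seriesD => //; apply: is_cvg_seriesD.
  by apply: (is_cvg_series_telescope (M := M)) => // n; exact: UM.
have bnd : cvgn (series (fun n => (L + 8 * M) * (a n * gamma n.+1))).
  have -> : (fun n => (L + 8 * M) * (a n * gamma n.+1)) =
    (L + 8 * M) *: (fun n => a n * gamma n.+1) by [].
  exact: is_cvg_seriesZ.
have le n : `|a n * (U n.+1 w - Pop (theta n w) (g (theta n w)) (Xn n.+1 w))| <=
    (L + 8 * M) * (a n * gamma n.+1).
  rewrite normrM ger0_norm// mulrCA ler_wpM2l//; apply: UL => //.
    by case/andP: (gamma01 n).
  by move=> i; exact: theta_close.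
suff : cvgn [normed series (fun n =>
    a n * (U n.+1 w - Pop (theta n w) (g (theta n w)) (Xn n.+1 w)))].
  by move/normed_cvg.
apply: (series_le_cvg _ _ _ bnd) => n.
- exact: normr_ge0.
- exact: le_trans (le n).
- exact: le.
Qed.

Lemma ae_cvg_series_iter g M L K : lip_family g M L ->
  {ae P, forall w, cvgn (series (fun n => a n * (g (theta n w) (Xn n.+1 w) -
    iter K (Pop (theta n w)) (g (theta n w)) (Xn n.+1 w))))}.
Proof.
move=> fg; elim: K => [|K IH].
  apply: aeW => w; have -> : (fun n => a n * (g (theta n w) (Xn n.+1 w) -
    iter 0 (Pop (theta n w)) (g (theta n w)) (Xn n.+1 w))) = cst 0.
    by apply/funext => n; rewrite /= subrr mulr0.
  have -> : series (cst 0) = cst 0 :> R ^nat.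
    by apply/funext => n; rewrite seriesEnat /= big1.
  exact: is_cvg_cst.
have := ae_cvg_series_increment (family_iter K fg).
apply: filterS2 IH => w h1 h2.
have := is_cvg_seriesD h1 h2.
congr (cvgn (series _)); apply/funext => n; rewrite !fctE /=; ring.
Qed.
End PoissonSeries.

(** * Almost sure convergence of theta and the law of large numbers *)

Hypothesis gamma_dec : forall n, gamma n.+2 <= gamma n.+1.
Hypothesis gamma_cvg : (fun n => gamma n.+1) @ \oo --> 0.
Hypothesis gamma_dvg : series (fun n => gamma n.+1) @ \oo --> +oo.
Hypothesis gamma_sqr : cvgn (series (fun n => gamma n.+1 ^+ 2)).

(** Equal to theta_star(I(x)) - theta(I(x)): the first-order decrease of the relative entropy per
    unit step when the chain lands at x. *)
Let h (th : 'I_nd -> R) x : R := \sum_(i < nd) (ts i - th i) * \1_(Xs i) x.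

Let family_h : lip_family h 1 1.
Proof.
split.
- move=> dT T th mth; apply: measurable_sum => i; apply: measurable_funM.
    apply: measurable_funB; first exact: measurable_cst.
    exact: (measurableT_comp (mth i) measurable_fst).
  by apply: (measurableT_comp _ measurable_snd); exact: measurable_indic.
- move=> th x [T _]; have [i xi] : exists i, Xs i x by case: part.
  rewrite /h (partition_sum (fun i => ts i - th i) xi) ler_norml.
  by have := T i; have := ts0 i; have := theta_star_le1 i; lra.
- move=> th th' s x [T _] _ s0 close; have [i xi] : exists i, Xs i x by case: part.
  rewrite /h (partition_sum (fun i => ts i - th' i) xi) (partition_sum (fun i => ts i - th i) xi).
  have -> : ts i - th' i - (ts i - th i) = - (th' i - th i) by ring.
  rewrite normrN mul1r (le_trans (close i))// -[leRHS]mulr1 ler_wpM2l//.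
  by apply/ltW; case/andP: (T i).
Qed.

Let eps K : R := (1 - rho) ^+ K * 2.

Let eps_cvg : eps @ \oo --> 0.
Proof.
have -> : 0 = 0 * 2 :> R by rewrite mul0r.
apply: cvgMl; apply: cvg_expr.
have r0 := rho_gt0; have r1 := rho_le1 (theta_in_Theta 0%N point).
by rewrite ger0_norm; lra.
Qed.

Lemma theta_cvg_ae : {ae P, forall w, forall i, (fun n => theta n w i) @ \oo --> ts i}.
Proof.
(* One null set must serve all K, since K is chosen after the precision [del]. *)
have aeK : {ae P, forall w K, cvgn (series (fun n => gamma n.+1 *
    (h (theta n w) (Xn n.+1 w) - iter K (Pop (theta n w)) (h (theta n w)) (Xn n.+1 w))))}.
  apply: ae_foralln => K.
  have g0 n : 0 <= gamma n.+1 by case/andP: (gamma01 n).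
  exact: (@ae_cvg_series_iter (fun n => gamma n.+1) g0 gamma_dec gamma_cvg
    gamma_sqr gamma_sqr _ _ _ _ family_h).
apply: filterS aeK => w hw.
have T n := theta_in_Theta n w.
have t0 n j : 0 < theta n w j by case: (T n) => /(_ j)/andP[].
have sum1 n : \sum_(j < nd) theta n w j = 1 by case: (T n).
have L_sqr n i : (theta n w i - ts i) ^+ 2 <= 4 * kl ts (theta n w).
  apply: kl_ge_sqr => // [j|j|]; last exact: theta_star_sum1.
    by rewrite ts0 theta_star_le1.
  by case: (T n) => /(_ j)/andP[-> /ltW].
suff Lcvg del : 0 < del -> \forall n \near \oo, kl ts (theta n w) <= del.
  move=> i; apply/cvgrPdist_le => e e0.
  have e4 : 0 < e ^+ 2 / 4 by rewrite divr_gt0// exprn_gt0.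
  have := Lcvg _ e4; apply: filterS => n Ln.
  rewrite distrC -ler_sqr ?nnegrE// ?(ltW e0)// real_normK ?num_real//.
  by apply: le_trans (L_sqr n i) _; lra.
move=> del0.
(* [kl_le_drift] is applied at level [2 * e]: [m / 4] meets its smallness condition, and
   [m * del / 8] turns its conclusion into [del / 2]. *)
pose e := Num.min (m / 4) (m * del / 8).
have e0 : 0 < e by rewrite /e lt_min !divr_gt0// mulr_gt0.
have [em ed] : e <= m / 4 /\ e <= m * del / 8.
  by rewrite /e !ge_min !lexx orbT.
have /cvgr0Pnorm_lt/(_ _ e0)[K _ eK] := eps_cvg.
have {}eK : eps K < e by apply: le_lt_trans (eK K (leqnn K)); exact: ler_norm.
pose D n := chi2 ts (theta n w) / Z (theta n w).
(* The remainder joins the second-order term of [kl_step] with the summable fluctuation of [h]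
   around its K-th iterate. *)
pose r n := 2 * gamma n.+1 ^+ 2 - gamma n.+1 *
  (h (theta n w) (Xn n.+1 w) - iter K (Pop (theta n w)) (h (theta n w)) (Xn n.+1 w)).
have -> : del = del / 2 + del / 2 by rewrite -splitr.
have L0 n : 0 <= kl ts (theta n w).
  have [i _] : exists i, Xs i point by case: part.
  have := L_sqr n i; have := sqr_ge0 (theta n w i - ts i); lra.
have D0 n : 0 <= D n.
  by rewrite divr_ge0 ?chi2_ge0 ?theta_star_sum1// ltW// Z_gt0.
have g0 n : 0 <= gamma n.+1 by case/andP: (gamma01 n).
have rcv : cvgn (series r).
  have -> : r = 2 *: (fun n => gamma n.+1 ^+ 2) - (fun n => gamma n.+1 *
    (h (theta n w) (Xn n.+1 w) - iter K (Pop (theta n w)) (h (theta n w)) (Xn n.+1 w))).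
    by [].
  by apply: is_cvg_seriesB; [exact: is_cvg_seriesZ|exact: hw].
apply: (@descent _ _ D (fun n => gamma n.+1) r e (del / 2) (del / 2)) => //.
- by rewrite divr_gt0.
(* [kl_step] requires [gamma <= 2^-1], which is available only eventually. *)
- have /cvgr0Pnorm_lt/(_ 2^-1) gs := gamma_cvg.
  have {}gs : \forall n \near \oo, `|gamma n.+1| < 2^-1 by apply: gs; rewrite invr_gt0.
  apply: filterS gs => n gn.
  have g12 : 0 <= gamma n.+1 <= 2^-1.
    by rewrite g0/= ltW//; apply: le_lt_trans gn; exact: ler_norm.
  have u1 j : `|\1_(Xs j) (Xn n.+1 w) - thetaI Xs (theta n w) (Xn n.+1 w)| <= 1.
    have /andP[? ?] := thetaI_itv (Xn n.+1 w) (T n).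
    by rewrite ler_norml indicE; case: (_ \in _) => /=; lra.
  have step := kl_step ts0 (t0 n) theta_star_sum1 g12 u1 (thS_mul n w).
  apply: le_trans step _.
  have -> : \sum_(j < nd) ts j * (\1_(Xs j) (Xn n.+1 w) - thetaI Xs (theta n w) (Xn n.+1 w)) =
      h (theta n w) (Xn n.+1 w).
    have [i xi] : exists i, Xs i (Xn n.+1 w) by case: part.
    under eq_bigr do rewrite mulrBr.
    rewrite sumrB -mulr_suml theta_star_sum1 mul1r (partition_sum _ xi) (thetaIE _ xi).
    by rewrite /h (partition_sum (fun i => ts i - theta n w i) xi).
  have bh : bmeas (h (theta n w)) := family_bmeas family_h (T n).
  have hle y : `|h (theta n w) y| <= 1 by case: family_h => _ + _; apply.
  have := iter_Pop_cvg (T n) K (Xn n.+1 w) bh hle.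
  rewrite pint_drift// mulr1 -/(eps K) -/(D n) ler_norml => /andP[lo _].
  have : gamma n.+1 * (D n - e) <= gamma n.+1 *
      iter K (Pop (theta n w)) (h (theta n w)) (Xn n.+1 w).
    by rewrite ler_wpM2l//; lra.
  by rewrite /r; lra.
- move=> n Dn; apply: (@le_trans _ _ (2 / m * (2 * e))).
    apply: kl_le_drift => //; [exact: theta_star_sum1| |]; first by rewrite mulr_ge0// ltW.
    lra.
  have -> : del / 2 = 2 / m * (m * del / 4) by field; rewrite gt_eqF.
  have m2 : 0 <= 2 / m by rewrite divr_ge0// ltW.
  by rewrite ler_wpM2l//; lra.
Qed.

Lemma is_cvg_series_harmonic_sqr : cvgn (series (fun n => (@harmonic R n) ^+ 2)).
Proof.
have tel : cvgn (series (fun n => 2 * (n.+1%:R^-1 - n.+2%:R^-1) : R)).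
  have -> : (fun n => 2 * (n.+1%:R^-1 - n.+2%:R^-1) : R) = (- 2) *: telescope (@harmonic R).
    by apply/funext => n; rewrite /telescope /harmonic !fctE /GRing.scale /=; ring.
  apply: is_cvg_seriesZ; rewrite telescopeK.
  apply: is_cvgB; last exact: is_cvg_cst.
  by apply/cvg_ex; exists 0; exact: cvg_harmonic.
have pos n : 0 <= 2 * (n.+1%:R^-1 - n.+2%:R^-1) :> R.
  by rewrite mulr_ge0// subr_ge0 lef_pV2 ?posrE ?ltr0n// ler_nat.
apply: (series_le_cvg _ pos _ tel) => n; first exact: sqr_ge0.
rewrite /harmonic /= -subr_ge0.
rewrite -[n.+2%:R]natr1; have a1 : 1 <= n.+1%:R :> R by rewrite ler1n.
move: n.+1%:R a1 => a a1.
have -> : 2 * (a^-1 - (a + 1)^-1) - a^-1 ^+ 2 = (a - 1) / (a ^+ 2 * (a + 1)).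
  by field; rewrite !gt_eqF//; lra.
by rewrite divr_ge0 ?subr_ge0// mulr_ge0 ?sqr_ge0//; lra.
Qed.

(** f splits into f - P^K f, whose average vanishes by Kronecker; P^K f minus its stationary mean,
    at most [eps K * M] uniformly; and the stationary mean at theta_k, which converges and hence
    does so in Cesaro mean. *)
Lemma LLN_ae (f : X -> R) : bmeas f ->
  {ae P, forall w, (fun n => n%:R^-1 * \sum_(0 <= k < n) f (Xn k.+1 w)) @ \oo --> pint ts f}.
Proof.
move=> bf; have [mf [M fM]] := bf.
have ff : lip_family (fun=> f) M 0.
  split; first by move=> dT T th _; exact: (measurableT_comp mf measurable_snd).
    by move=> th x _; exact: fM.
  by move=> th th' s x _ _ _ _; rewrite subrr normr0 mul0r.
have h0 n : 0 <= @harmonic R n by rewrite /harmonic /= invr_ge0.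
have hdec n : @harmonic R n.+1 <= @harmonic R n.
  by rewrite /harmonic /= lef_pV2 ?posrE ?ltr0n// ler_nat.
have hgam : cvgn (series (fun n => @harmonic R n * gamma n.+1)).
  have S : cvgn (series (fun n => @harmonic R n ^+ 2 + gamma n.+1 ^+ 2)).
    exact: is_cvg_seriesD is_cvg_series_harmonic_sqr gamma_sqr.
  have g0 n : 0 <= gamma n.+1 by case/andP: (gamma01 n).
  apply: (series_le_cvg _ _ _ S) => n; first exact: mulr_ge0.
    by rewrite addr_ge0 ?sqr_ge0.
  by have := sqr_ge0 (@harmonic R n - gamma n.+1); have := mulr_ge0 (h0 n) (g0 n); nra.
have aeK : {ae P, forall w K, cvgn (series (fun n => @harmonic R n *
    (f (Xn n.+1 w) - iter K (Pop (theta n w)) f (Xn n.+1 w))))}.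
  apply: ae_foralln => K.
  exact: (@ae_cvg_series_iter _ h0 hdec cvg_harmonic is_cvg_series_harmonic_sqr hgam _ _ _ _ ff).
apply: filterS2 aeK theta_cvg_ae => w hw tcv.
have pcv : (fun n => pint (theta n w) f) @ \oo --> pint ts f.
  apply: pint_cvg => // [n|]; first exact: theta_in_Theta.
  exact: theta_star_in_Theta.
apply/cvgrPdist_le => e e0.
have e3 : 0 < e / 3 by rewrite divr_gt0.
have M0 : 0 <= M by apply: le_trans (fM point).
have [K hK] : exists K, eps K * M <= e / 3.
  have : (fun K => eps K * M) @ \oo --> 0 * M by exact: cvgMl eps_cvg.
  rewrite mul0r => /cvgr0Pnorm_le/(_ _ e3)[K _ hK]; exists K.
  by apply: le_trans (hK K (leqnn K)); exact: ler_norm.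
have /kronecker/cvgr0Pnorm_le/(_ _ e3) k1 := hw K.
have /cvgrPdist_le/(_ _ e3) k2 := cesaro_mean pcv.
apply: filterS2 k1 k2 => n; set A := n%:R^-1 * _; set B := n%:R^-1 * _.
set C' := n%:R^-1 * _ => hA hB.
have CE : C' = A + B + n%:R^-1 * \sum_(0 <= k < n)
    (iter K (Pop (theta k w)) f (Xn k.+1 w) - pint (theta k w) f).
  rewrite -!mulrDr -!big_split /=; congr (_ * _).
  by apply: eq_bigr => k _; ring.
have D3 : `|n%:R^-1 * \sum_(0 <= k < n)
    (iter K (Pop (theta k w)) f (Xn k.+1 w) - pint (theta k w) f)| <= e / 3.
  have [->|n0] := posnP n; first by rewrite big_geq// mulr0 normr0 ltW.
  rewrite normrM ger0_norm ?invr_ge0// ler_pdivrMl ?ltr0n//.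
  apply: le_trans (ler_norm_sum _ _ _) _.
  apply: (@le_trans _ _ (\sum_(0 <= k < n) e / 3)).
    apply: ler_sum => k _; apply: le_trans hK.
    rewrite /eps -mulrA; apply: iter_Pop_cvg => //; exact: theta_in_Theta.
  by rewrite sumr_const_nat subn0 mulr_natl.
rewrite CE; move: D3; set D := (X in `|X| <= _ -> _) => D3.
have -> : pint ts f - (A + B + D) = (pint ts f - B) - A - D by ring.
rewrite (le_trans (ler_normB _ _))//.
apply: (@le_trans _ _ (e / 3 + e / 3 + e / 3)); last lra.
by rewrite lerD// (le_trans (ler_normB _ _))// lerD.
Qed.

Lemma In_f_cvg_ae (f : X -> R) : bmeas f ->
  {ae P, forall w, (fun n => In_f Xs f (theta n w) (fun k => Xn k w) n) @ \oo -->
    \int[lambda]_x (f x * pi x)}.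
Proof.
move=> bf.
(* The strata are indexed through naturals so that a countable intersection of almost sure events
   applies; indices from [nd] on are vacuous. *)
have aei : {ae P, forall w j (i : 'I_nd), i = j :> nat -> (fun n => n%:R^-1 *
    \sum_(0 <= k < n) f (Xn k.+1 w) * \1_(Xs i) (Xn k.+1 w)) @ \oo -->
    pint ts (fun x => f x * \1_(Xs i) x)}.
  apply: ae_foralln => j; have [jn|nj] := ltnP j nd; last first.
    by apply: aeW => w i ij; have := ltn_ord i; rewrite ij ltnNge nj.
  have bfi : bmeas (fun x => f x * \1_(Xs (Ordinal jn)) x).
    by apply: bmeasM => //; exact: bmeas_indic.
  apply: filterS (LLN_ae bfi) => w hw i ij.
  by have -> : i = Ordinal jn by exact: val_inj.
apply: filterS2 aei theta_cvg_ae => w hw tcv.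
rewrite -pint_theta_star//; apply: cvgMr; apply: sum_cvg => i; apply: cvgM; first exact: tcv.
have -> : (fun n => n%:R^-1 * \sum_(1 <= k < n.+1) f (Xn k w) * \1_(Xs i) (Xn k w)) =
    (fun n => n%:R^-1 * \sum_(0 <= k < n) f (Xn k.+1 w) * \1_(Xs i) (Xn k.+1 w)).
  by apply/funext => n; rewrite big_add1.
exact: (hw i i erefl).
Qed.

(** * Convergence of expectations *)

Let EX (f : X -> R) n := \int[P]_w f (Xn n w).

Let bmeas_fX (f : X -> R) n : bmeas f -> bmeas (fun w => f (Xn n w)).
Proof.
move=> [mf [M fM]]; split; first exact: (measurableT_comp mf (mXn n)).
by exists M.
Qed.

(** [freezing] rewrites the expectation at time n+1 with the kernel at theta_n. As theta_star has
    positive coordinates, theta_n becomes close to it in relative terms, so replacing the kernel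
    costs an error uniform in the state. *)
Let EX_step (f : X -> R) : bmeas f -> (fun n => EX f n.+1 - EX (Pop ts f) n) @ \oo --> 0.
Proof.
move=> bf; have [mf [M fM]] := bf; have Ts := theta_star_in_Theta nd2.
have bfG n : bmeas (fun z : g_sigma_algebraType (WL_gen n) * X => f z.2).
  split; first exact: (measurableT_comp mf measurable_snd).
  by exists M.
have bP n : bmeas (fun w => Pop (theta n w) f (Xn n w)).
  split.
    exact: (adapted_measurable WL_gen_measurable (@cond_adapted n _ (bfG n))).
  by exists M => w; apply: Pop_norm => //; exact: theta_in_Theta.
have bPs := bmeas_fX _ (bmeas_Pop Ts bf).
have -> : (fun n => EX f n.+1 - EX (Pop ts f) n) =
    (fun n => \int[P]_w (Pop (theta n w) f (Xn n w) - Pop ts f (Xn n w))).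
  apply/funext => n; rewrite /EX (bmeas_RintegralB _ (bP n) (bPs n)).
  by congr (_ - _); exact: (freezing (bfG n)).
have -> : 0 = \int[P]_w (0 : R) by rewrite prob_Rintegral_cst.
apply: (@bmeas_cvg_Rintegral _ _ _ P _ _ (2 * M)).
- by move=> n; case: (bmeasB (bP n) (bPs n)).
- exact: measurable_cst.
- move=> n w; rewrite (le_trans (ler_normB _ _))// mulr_natl mulr2n lerD//.
    by apply: Pop_norm => //; exact: theta_in_Theta.
  exact: Pop_norm.
apply: filterS theta_cvg_ae => w tcv; apply/cvgr0Pnorm_le => e e0.
have M0 : 0 <= M by apply: le_trans (fM point).
(* Chosen so that [8 * M * s <= e]; the 1 covers [M = 0]. *)
pose s := e / (8 * M + 1).
have s0 : 0 < s by rewrite divr_gt0// ltr_wpDl// mulr_ge0.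
have : \forall n \near \oo, forall i, `|theta n w i - ts i| <= s * ts i.
  apply: filter_forall => i.
  have /cvgrPdist_le/(_ (s * ts i)) := tcv i.
  rewrite mulr_gt0// => /(_ isT); apply: filterS => n; by rewrite distrC.
apply: filterS => n close.
apply: (le_trans (Pop_lipschitz _ Ts (theta_in_Theta n w) (ltW s0) close mf fM)).
rewrite /s mulrCA ger_pMr// ler_pdivrMr ?ltr_wpDl ?mulr_ge0//.
by rewrite mul1r lerDl.
Qed.

Let EX_iter (f : X -> R) K : bmeas f ->
  (fun n => EX f (n + K)%N - EX (iter K (Pop ts) f) n) @ \oo --> 0.
Proof.
have Ts := theta_star_in_Theta nd2.
move=> bf; elim: K => [|K IH].
  have -> : (fun n => EX f (n + 0)%N - EX (iter 0 (Pop ts) f) n) = cst 0.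
    by apply/funext => n; rewrite addn0 subrr.
  exact: cvg_cst.
have -> : (fun n => EX f (n + K.+1)%N - EX (iter K.+1 (Pop ts) f) n) =
    (fun n => EX f (n.+1 + K)%N - EX (iter K (Pop ts) f) n.+1) +
    (fun n => EX (iter K (Pop ts) f) n.+1 - EX (Pop ts (iter K (Pop ts) f)) n).
  by apply/funext => n; rewrite !fctE addnS /=; ring.
rewrite -[0]addr0; apply: cvgD; last exact/EX_step/bmeas_iter_Pop.
by have := IH; rewrite -cvg_shiftS.
Qed.

(** K steps before time n the chain may have any law, because the K-step bound at theta_star is
    uniform in the starting point. *)
Lemma EX_cvg (f : X -> R) : bmeas f -> EX f @ \oo --> pint ts f.
Proof.
move=> bf; have [mf [M fM]] := bf; have Ts := theta_star_in_Theta nd2.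
apply/cvgrPdist_le => e e0.
have e2 : 0 < e / 2 by rewrite divr_gt0.
have [K hK] : exists K, eps K * M <= e / 2.
  have : (fun K => eps K * M) @ \oo --> 0 * M by exact: cvgMl eps_cvg.
  rewrite mul0r => /cvgr0Pnorm_le/(_ _ e2)[K _ hK]; exists K.
  by apply: le_trans (hK K (leqnn K)); exact: ler_norm.
have /cvgr0Pnorm_le/(_ _ e2)[N _ hN] := EX_iter K bf.
exists (N + K)%N => // n /= Nn; have Kn : (K <= n)%N by apply: leq_trans Nn; rewrite leq_addl.
have := hN (n - K)%N; rewrite /= leq_subRL// addnC => /(_ Nn); rewrite subnK// => h1.
have bK := bmeas_iter_Pop Ts K bf.
have h2 : `|EX (iter K (Pop ts) f) (n - K) - pint ts f| <= e / 2.
  rewrite /EX -(prob_Rintegral_cst P (pint ts f)).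
  rewrite -(bmeas_RintegralB _ (bmeas_fX _ bK) (bmeas_cst _ _)).
  have bd := bmeasB (bmeas_fX (n - K) bK) (bmeas_cst _ (pint ts f)).
  apply: le_trans (le_normr_Rintegral measurableT (bmeas_integrable _ bd)) _.
  rewrite -[leRHS](prob_Rintegral_cst P).
  apply: le_Rintegral => //.
  - exact: integrable_norm (bmeas_integrable _ bd).
  - exact: bmeas_integrable (bmeas_cst _ _).
  - move=> w _; apply: le_trans hK; rewrite /eps -mulrA.
    exact: iter_Pop_cvg.
rewrite distrC; have -> : EX f n - pint ts f =
    (EX f n - EX (iter K (Pop ts) f) (n - K)) +
    (EX (iter K (Pop ts) f) (n - K) - pint ts f) by ring.
by rewrite (splitr e) (le_trans (ler_normD _ _))// lerD.
Qed.

Lemma bmeas_integrand (f : X -> R) n : bmeas f -> bmeas (fun w =>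
  nd%:R * \sum_(i < nd) theta n w i * f (Xn n w) * \1_(Xs i) (Xn n w)).
Proof.
move=> bf; apply: bmeasM; first exact: bmeas_cst.
apply: bmeas_sum => i; apply: bmeasM; last exact: bmeas_fX (bmeas_indic R (Xs_meas i)).
apply: bmeasM; last exact: bmeas_fX.
split; first exact: (adapted_measurable WL_gen_measurable (@theta_adapted n i)).
exists 1 => w; have [/(_ i)/andP[t0 t1] _] := theta_in_Theta n w.
by rewrite ger0_norm ltW.
Qed.

(** Replacing theta_n by theta_star costs an expectation that vanishes by bounded convergence; what
    remains is [EX_cvg] stratum by stratum. *)
Lemma expectation_cvg (f : X -> R) : bmeas f ->
  (fun n => \int[P]_w (nd%:R * \sum_(i < nd) theta n w i * f (Xn n w) * \1_(Xs i) (Xn n w)))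
    @ \oo --> \int[lambda]_x (f x * pi x).
Proof.
move=> bf; have [mf [M fM]] := bf; have M0 : 0 <= M by apply: le_trans (fM point).
have Ts := theta_star_in_Theta nd2.
have bfi i : bmeas (fun x => f x * \1_(Xs i) x).
  by apply: bmeasM => //; exact: bmeas_indic.
have bti n i : bmeas (fun w => theta n w i).
  split; first exact: (adapted_measurable WL_gen_measurable (@theta_adapted n i)).
  exists 1 => w; have [/(_ i)/andP[t0 t1] _] := theta_in_Theta n w.
  by rewrite ger0_norm ltW.
rewrite -pint_theta_star//.
have -> : (fun n => \int[P]_w
    (nd%:R * \sum_(i < nd) theta n w i * f (Xn n w) * \1_(Xs i) (Xn n w))) =
    (fun n => nd%:R * \sum_(i < nd)
      (\int[P]_w ((theta n w i - ts i) * (f (Xn n w) * \1_(Xs i) (Xn n w))) +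
       ts i * EX (fun x => f x * \1_(Xs i) x) n)).
  apply/funext => n.
  have b1 i : bmeas (fun w => (theta n w i - ts i) * (f (Xn n w) * \1_(Xs i) (Xn n w))).
    exact: (bmeasM (bmeasB (bti n i) (bmeas_cst _ _)) (bmeas_fX n (bfi i))).
  have b2 i : bmeas (fun w => ts i * (f (Xn n w) * \1_(Xs i) (Xn n w))).
    exact: (bmeasM (bmeas_cst _ _) (bmeas_fX n (bfi i))).
  have b3 i := bmeasD (b1 i) (b2 i).
  transitivity (\int[P]_w (nd%:R * \sum_(i < nd)
      ((theta n w i - ts i) * (f (Xn n w) * \1_(Xs i) (Xn n w)) +
       ts i * (f (Xn n w) * \1_(Xs i) (Xn n w))))).
    by apply: eq_Rintegral => w _; congr (_ * _); apply: eq_bigr => i _; ring.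
  rewrite (bmeas_RintegralZl _ _ (bmeas_sum _ b3)) (bmeas_Rintegral_sum _ _ b3).
  congr (_ * _); apply: eq_bigr => i _.
  by rewrite (bmeas_RintegralD _ (b1 i) (b2 i)) (bmeas_RintegralZl _ _ (bmeas_fX n (bfi i))).
apply: cvgMr; apply: sum_cvg => i; rewrite -[ts i * pint ts _]add0r; apply: cvgD; last first.
  by apply: cvgMr; exact: EX_cvg.
have -> : 0 = \int[P]_w (0 : R) by rewrite prob_Rintegral_cst.
apply: (@bmeas_cvg_Rintegral _ _ _ P _ _ (1 * M)).
- move=> n.
  by case: (bmeasM (bmeasB (bti n i) (bmeas_cst _ (ts i))) (bmeas_fX n (bfi i))).
- exact: measurable_cst.
- move=> n w; rewrite normrM ler_pM//.
    have [/(_ i)/andP[t0 t1] _] := theta_in_Theta n w; have := ts0 i; have := theta_star_le1 i.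
    by rewrite ler_norml; lra.
  by rewrite indicE; case: (_ \in _); rewrite ?mulr1// mulr0 normr0.
apply: filterS theta_cvg_ae => w tcv; apply/cvgr0Pnorm_le => e e0.
have s0 : 0 < e / (M + 1) by rewrite divr_gt0// ltr_wpDl.
have /cvgrPdist_le/(_ _ s0) := tcv i; apply: filterS => n; rewrite distrC => hn.
rewrite normrM (@le_trans _ _ (e / (M + 1) * M))//.
  by rewrite ler_pM// indicE; case: (_ \in _); rewrite ?mulr1// mulr0 normr0.
by rewrite mulrAC ler_pdivrMr ?ltr_wpDl// ler_wpM2l ?(ltW e0)// lerDl.
Qed.

End MetropolisHastings.

(** * Reduction to a finite reference measure and conclusion *)

Lemma finite_measure_of (R : realType) d (T : measurableType d)
    (mu : {measure set T -> \bar R}) : fin_num_fun mu ->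
  exists nu : {finite_measure set T -> \bar R}, (nu : {measure set T -> \bar R}) = mu.
Proof.
case: mu => f cls /= finf.
pose mu := Measure.Pack cls.
pose mix := Measure_isFinite.Build d T R mu finf.
pose nu : {finite_measure set T -> \bar R} := HB.pack (Measure.sort mu) mix.
by exists nu.
Qed.

Theorem theorem4 (R : realType) (dX : measure_display) (X : measurableType dX)
  (lambda : {measure set X -> \bar R}) (pi : X -> R) (d : nat) (Xs : 'I_d -> set X)
  (q : X -> X -> R) (gamma : nat -> R)
  (dO : measure_display) (Omega : measurableType dO) (P : probability Omega R)
  (Xn : nat -> Omega -> X) (theta : nat -> Omega -> 'I_d -> R) :
  (* setting *)
  polish_borel R X ->
  sigma_finite setT lambda ->
  measurable_fun setT pi -> (forall x, 0 <= pi x) ->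
  (\int[lambda]_x (pi x)%:E = 1)%E ->
  (2 <= d)%N -> measurable_partition Xs ->
  (* (A1) *)
  (exists2 c : R, 0 < c & forall x, c <= pi x) ->
  (exists C : R, forall x, pi x <= C) ->
  (forall i, 0 < theta_star lambda pi Xs i) ->
  (* (A2) : q symmetric proposal density w.r.t. lambda with positive infimum *)
  measurable_fun setT (fun z : X * X => q z.1 z.2) ->
  (forall x y, 0 <= q x y) ->
  (forall x, (\int[lambda]_y (q x y)%:E = 1)%E) ->
  (forall x y, q x y = q y x) ->
  (exists2 c : R, 0 < c & forall x y, c <= q x y) ->
  (* (A3) : gamma_n, n >= 1 *)
  (forall n, 0 <= gamma n.+1 < 1) ->
  (forall n, gamma n.+2 <= gamma n.+1) ->
  gamma @ \oo --> 0 ->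
  (fun n => \sum_(k < n) gamma k.+1) @ \oo --> +oo ->
  cvg ((fun n => \sum_(k < n) gamma k.+1 ^+ 2) @ \oo) ->
  (* linearized Wang-Landau algorithm *)
  (forall n, measurable_fun setT (Xn n)) ->
  (forall i, measurable_fun setT (fun w => theta 0%N w i)) ->
  (forall w, in_Theta (theta 0%N w)) ->
  (forall n w i, theta n.+1 w i =
      theta n w i + gamma n.+1 * Hwl Xs (Xn n.+1 w) (theta n w) i) ->
  (forall n (B : set Omega) (A : set X),
      WL_filtration (theta 0%N) Xn n B -> measurable A ->
      P (B `&` Xn n.+1 @^-1` A) =
        (\int[P]_(w in B) (mh_kernel lambda pi Xs q (theta n w) (Xn n w) A)%:E)%E) ->
  (* conclusion *)
  forall f : X -> R, measurable_fun setT f -> (exists M : R, forall x, `|f x| <= M) ->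
    (fun n => (\int[P]_w
        (d%:R * \sum_(i < d) theta n w i * f (Xn n w) * \1_(Xs i) (Xn n w))%:E)%E)
      @ \oo --> (\int[lambda]_x (f x * pi x)%:E)%E
  /\ {ae P, forall w, (fun n => In_f Xs f (theta n w) (fun k => Xn k w) n)
                        @ \oo --> fine (\int[lambda]_x (f x * pi x)%:E)%E}.
Proof.
move=> _ _ mpi _ pi1 d2 part [c c0 cpi] [C piC] star0 mq q0 q1 qC [cq cq0 cqq].
move=> gamma01 gamma_dec gamma_cvg gamma_dvg gamma_sqr mXn mth0 Tth0 thS trans f mf [M fM].
(* Integrating [c <= pi] gives total mass at most [c^-1]. *)
have fin : fin_num_fun lambda.
  have lT : (lambda setT <= (c^-1)%:E)%E.
    have : (\int[lambda]_x c%:E <= 1)%E.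
      rewrite -pi1; apply: ge0_le_integral => //.
      - by move=> x _; rewrite lee_fin ltW.
      - exact/measurable_EFinP.
      - by move=> x _; rewrite lee_fin.
    by rewrite integral_cst// -lee_pdivlMl// mule1.
  move=> A mA; rewrite ge0_fin_numE//; apply: le_lt_trans (ltry (c^-1)).
  by apply: le_trans lT; apply: le_measure; rewrite ?inE.
have [lam E] := finite_measure_of fin.
subst lambda.
(* A lower bound of all theta_star(i) that avoids taking a minimum: each inverse is at most the sum
   of the inverses. *)
pose m := (\sum_(i < d) (theta_star lam pi Xs i)^-1)^-1.
have S0 i : (theta_star lam pi Xs i)^-1 <= \sum_(i < d) (theta_star lam pi Xs i)^-1.
  by rewrite (bigD1 i)//= lerDl; apply: sumr_ge0 => j _; rewrite invr_ge0 ltW.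
have i0 : 'I_d by exact: Ordinal (ltnW d2).
have m0 : 0 < m.
  by rewrite invr_gt0; apply: lt_le_trans (S0 i0); rewrite invr_gt0.
have mstar i : m <= theta_star lam pi Xs i.
  rewrite -[leRHS]invrK lef_pV2 ?posrE ?invr_gt0//.
  by move: m0; rewrite invr_gt0.
have gamma_cvg' : (fun n => gamma n.+1) @ \oo --> 0.
  by have := gamma_cvg; rewrite -cvg_shiftS.
have ser (u : nat -> R) : (fun n => \sum_(k < n) u k) = series u.
  by apply/funext => n; rewrite seriesEnat /= big_mkord.
have gamma_dvg' : series (fun n => gamma n.+1) @ \oo --> +oo by rewrite -ser.
have gamma_sqr' : cvgn (series (fun n => gamma n.+1 ^+ 2)) by rewrite -ser.
have bf : bmeas f by split => //; exists M.
have bpi : bmeas pi.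
  by split => //; exists C => x; rewrite ger0_norm// (le_trans (ltW c0)).
have H1 := @expectation_cvg _ _ _ lam pi d Xs q c C m cq mpi pi1 part c0 cpi piC m0 mstar
  mq q0 q1 qC cq0 cqq _ _ P Xn theta gamma d2 gamma01 mXn mth0 Tth0 thS trans
  gamma_dec gamma_cvg' gamma_dvg' gamma_sqr' f bf.
have H2 := @In_f_cvg_ae _ _ _ lam pi d Xs q c C m cq mpi pi1 part c0 cpi piC m0 mstar
  mq q0 q1 qC cq0 cqq _ _ P Xn theta gamma d2 gamma01 mXn mth0 Tth0 thS trans
  gamma_dec gamma_cvg' gamma_dvg' gamma_sqr' f bf.
have bI n : bmeas (fun w =>
    d%:R * \sum_(i < d) theta n w i * f (Xn n w) * \1_(Xs i) (Xn n w)).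
  exact: (bmeas_integrand part d2 gamma01 mXn mth0 Tth0 thS n bf).
split; last exact: H2.
rewrite (bmeas_RintegralE lam (bmeasM bf bpi)).
under eq_fun do rewrite (bmeas_RintegralE P (bI _)).
by apply: cvg_EFin; [exact: nearW|exact: H1].
Qed.
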